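(* (Failure energy of a flat crack is the Griffith energy.) Fix $\epsilon>0$. Let $R_t$ be a flat $(d-1)$-dimensional piece of surface in $\Omega$ (a piece of a plane if $d=3$, a line segment if $d=2$), and suppose the failure set $\Gamma^\epsilon(t)$ is the one defined by $R_t$: points above the surface are no longer influenced by forces due to points below the surface and vice versa, i.e. $\Gamma^\epsilon(t)$ consists of the pairs $(\mathbf{x},\mathbf{y})\in\Omega\times(\Omega\cap H_\epsilon(\mathbf{x}))$ for which the segment joining $\mathbf{x}$ and $\mathbf{y}$ crosses $R_t$ (all bonds connecting points on one side of $R_t$ to points on the other side through $R_t$ are broken). Then $$\mathcal{F}^\epsilon(t)=\mathcal{G}_c\,\mathcal{H}^{d-1}(R_t),$$ where $\mathcal{H}^{d-1}$ is $(d-1)$-dimensional Hausdorff measure.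
   Context: Let $d\in\{2,3\}$, $\Omega\subset\mathbb{R}^d$ a bounded domain, $C^+>0$ a constant (the asymptotic value of the bond potential for large tensile strain). $H_\epsilon(\mathbf{x})=\{\mathbf{y}:|\mathbf{y}-\mathbf{x}|<\epsilon\}$; $\omega_n$ is the volume of the unit ball in $\mathbb{R}^n$ ($\omega_1=2,\omega_2=\pi,\omega_3=4\pi/3$). The kernel is $\rho^\epsilon(\mathbf{y},\mathbf{x})=\chi_\Omega(\mathbf{y})J(|\mathbf{y}-\mathbf{x}|/\epsilon)/(\epsilon\,\omega_d\epsilon^d)$, where $\chi_\Omega$ is the characteristic function of $\Omega$ and $J:[0,\infty)\to[0,\infty)$ is decreasing, positive on $[0,1)$, $J(0)=M<\infty$, $J=0$ on $[1,\infty)$. The failure set $\Gamma^\epsilon(t)$ is the set of pairs $(\mathbf{x},\mathbf{y})\in\Omega\times(\Omega\cap H_\epsilon(\mathbf{x}))$ whose bond is broken by time $t$; $\chi^+(\mathbf{y},\mathbf{x},t)=1$ if $(\mathbf{x},\mathbf{y})\in\Gamma^\epsilon(t)$ and $0$ otherwise. The failure energy is $\mathcal{F}^\epsilon(t)=\int_\Omega\int_\Omega\rho^\epsilon(\mathbf{y},\mathbf{x})\,C^+\,\chi^+(\mathbf{y},\mathbf{x},t)\,d\mathbf{y}\,d\mathbf{x}$. The critical energy release rate of the model is $\mathcal{G}_c=C^+\frac{2\omega_{d-1}}{\omega_d}\int_0^1 q^dJ(q)\,dq$.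
   Formalization: The formal theorem additionally assumes that the ε-ball around every point of R_t lies in Ω; without this the claim fails, since Ω truncates the bonds crossing R_t near the boundary and the failure energy is then strictly smaller. *)

(* Defs.v *)
From HB Require Import structures.
From mathcomp Require Import all_boot all_order all_algebra.
From mathcomp Require Import all_classical all_reals all_analysis.

Set Implicit Arguments.
Unset Strict Implicit.
Unset Printing Implicit Defensive.

Import Order.TTheory GRing.Theory Num.Theory.
Import numFieldTopology.Exports numFieldNormedType.Exports.

Local Open Scope classical_set_scope.
Local Open Scope ring_scope.

(* R^n is 'rV[R]_n with the sigma-algebra generated by the coordinates, i.e.
   the Borel sigma-algebra, as for n.-tuple R. *)
Definition measure_rV_display : measure_display -> measure_display.
Proof. exact. Qed.

Definition rV_coord {T : Type} {n : nat} (i : 'I_n) (v : 'rV[T]_n) : T :=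
  v ord0 i.

Section measurable_rV.
Context {d} {T : sigmaRingType d}.
Variable n : nat.

Let coors : 'I_n -> 'rV[T]_n -> T := @rV_coord T n.

Let rV_set0 : g_sigma_preimage coors set0.
Proof. exact: sigma_algebra0. Qed.

Let rV_setC A : g_sigma_preimage coors A -> g_sigma_preimage coors (~` A).
Proof. exact: sigma_algebraC. Qed.

Let rV_bigcup (F : _^nat) : (forall i, g_sigma_preimage coors (F i)) ->
  g_sigma_preimage coors (\bigcup_i (F i)).
Proof. exact: sigma_algebra_bigcup. Qed.

HB.instance Definition _ := @isMeasurable.Build (measure_rV_display d)
  'rV[T]_n (g_sigma_preimage coors) rV_set0 rV_setC rV_bigcup.

End measurable_rV.

Section lebesgue_rV.
Context {R : realType}.

Lemma measurable_rV_coord n (i : 'I_n) :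
  measurable_fun [set: 'rV[R]_n] (@rV_coord R n i).
Proof.
move=> _ Y mY; rewrite setTI; apply: sub_sigma_algebra => /=.
rewrite -bigcup_seq/=; exists i => /=; first by rewrite mem_index_enum.
by exists Y => //; rewrite setTI.
Qed.

Lemma measurable_fun_rV d (T : measurableType d) n (f : T -> 'rV[R]_n) :
  (forall i, measurable_fun [set: T] (@rV_coord R n i \o f)) ->
  measurable_fun [set: T] f.
Proof.
move=> mf _ Y mY; rewrite setTI.
suff : g_sigma_preimage (fun i => @rV_coord R n i \o f) `<=` measurable.
  by apply; rewrite g_sigma_preimage_comp; exists Y => //; rewrite setTI.
apply: smallest_sub; first exact: sigma_algebra_measurable.
rewrite -bigcup_seq/=; apply: bigcup_sub => i _.
by move=> A [B mB <-]; exact: mf.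
Qed.

Definition rV_cons n (p : measurableTypeR R * 'rV[R]_n) : 'rV[R]_n.+1 :=
  row_mx (const_mx p.1 : 'rV_1) p.2.

Definition rV_uncons n (v : 'rV[R]_n.+1) : measurableTypeR R * 'rV[R]_n :=
  (v ord0 ord0, rsubmx (v : 'rV_(1 + n))).

Lemma rV_consK n : cancel (@rV_cons n) (@rV_uncons n).
Proof.
move=> [x v]; rewrite /rV_uncons /rV_cons /= row_mxKr; congr pair.
have E : (ord0 : 'I_(1 + n)) = lshift n ord0 by apply: val_inj.
by have := @row_mxEl R 1 1 n (const_mx x) v ord0 ord0; rewrite -E => ->; rewrite mxE.
Qed.

Lemma measurable_rV_cons n : measurable_fun setT (@rV_cons n).
Proof.
apply: measurable_fun_rV => i.
case: (split_ordP (i : 'I_(1 + n))) => j ->.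
  rewrite (_ : _ \o _ = fst); first exact: measurable_fst.
  apply/funext => p.
  exact: etrans (row_mxEl (const_mx p.1) p.2 ord0 j) (mxE _ _ _ _).
rewrite (_ : _ \o _ = @rV_coord R n j \o snd).
  exact: measurableT_comp (measurable_rV_coord j) measurable_snd.
by apply/funext => p; exact: (row_mxEr (const_mx p.1 : 'rV_1) p.2 ord0 j).
Qed.

Lemma measurable_rV_uncons n : measurable_fun setT (@rV_uncons n).
Proof.
apply/measurable_fun_pairP; split.
  exact: (measurable_rV_coord (ord0 : 'I_n.+1)).
apply: measurable_fun_rV => j.
rewrite (_ : _ \o _ = @rV_coord R n.+1 (rshift 1 j)).
  exact: measurable_rV_coord.
by apply/funext => v; rewrite /rV_coord /= mxE.
Qed.

Section step.
Variables (n : nat) (mu : {sigma_finite_measure set 'rV[R]_n -> \bar R}).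

Definition lebesgue_rV_step : set 'rV[R]_n.+1 -> \bar R :=
  pushforward (lebesgue_measure \x mu)%E (@rV_cons n).

Let mcons : measurable_fun setT (@rV_cons n) := @measurable_rV_cons n.

Let lebesgue_rV_step0 : lebesgue_rV_step set0 = 0%E.
Proof. exact: measure0. Qed.

Let lebesgue_rV_step_ge0 A : (0 <= lebesgue_rV_step A)%E.
Proof. exact: measure_ge0. Qed.

Let lebesgue_rV_step_sigma_additive : semi_sigma_additive lebesgue_rV_step.
Proof. exact: measure_semi_sigma_additive. Qed.

HB.instance Definition _ := isMeasure.Build _ _ _ lebesgue_rV_step
  lebesgue_rV_step0 lebesgue_rV_step_ge0 lebesgue_rV_step_sigma_additive.

Let lebesgue_rV_step_sigma_finite : sigma_finite setT lebesgue_rV_step.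
Proof.
have /sigma_finiteP[F [TF ndF Foo]] := sigma_finiteT (@lebesgue_measure R).
have /sigma_finiteP[G [TG ndG Goo]] := sigma_finiteT mu.
exists (fun k => @rV_uncons n @^-1` (F k `*` G k)).
  apply/esym; rewrite -preimage_bigcup predeqE => v; split => // _.
  have [k _ Fk] : (\bigcup_k F k) (rV_uncons v).1 by rewrite -TF.
  have [l _ Gl] : (\bigcup_k G k) (rV_uncons v).2 by rewrite -TG.
  exists (maxn k l) => //; split.
  - by move: Fk; apply/subsetPset/ndF/leq_maxl.
  - by move: Gl; apply/subsetPset/ndG/leq_maxr.
move=> k; have [mF Fk] := Foo k; have [mG Gk] := Goo k.
have mFG : measurable (F k `*` G k) by exact: measurableX.
split; first by rewrite -[X in measurable X]setTI; exact: measurable_rV_uncons.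
rewrite /lebesgue_rV_step /pushforward -comp_preimage.
rewrite (_ : _ \o _ = id); last by apply/funext => p; exact: rV_consK.
by rewrite preimage_id product_measure1E// lte_mul_pinfty// ge0_fin_numE.
Qed.

HB.instance Definition _ :=
  Measure_isSigmaFinite.Build _ _ _ lebesgue_rV_step
    lebesgue_rV_step_sigma_finite.
End step.

(* n-dimensional Lebesgue measure, as an n-fold product. *)
Fixpoint lebesgue_rV n : {sigma_finite_measure set 'rV[R]_n -> \bar R} :=
  match n with
  | 0 => \d_(0 : 'rV[R]_0)
  | n'.+1 => lebesgue_rV_step (lebesgue_rV n')
  end.

End lebesgue_rV.

Section euclidean.
Context {R : realType} {n : nat}.
Implicit Types (u v x y p nu : 'rV[R]_n) (A U : set 'rV[R]_n).

(* The library norm on 'rV[R]_n is the sup norm, hence a separate Euclidean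
   norm. *)
Definition dotp u v : R := \sum_i u ord0 i * v ord0 i.

Definition enorm v : R := Num.sqrt (dotp v v).

(* H_eps(x) *)
Definition horizon (eps : R) x : set 'rV[R]_n := [set y | enorm (y - x) < eps].

Definition domain A : Prop := [/\ open A, connected A & A !=set0].

(* The maximum with 0 only matters for U = set0. *)
Definition ediam U : \bar R :=
  maxe 0%E (ereal_sup [set (enorm (z.1 - z.2))%:E | z in U `*` U]).

Definition hyperplane p nu : set 'rV[R]_n := [set x | dotp nu (x - p) = 0].

(* A (Borel) piece S of the hyperplane through p with unit normal nu. *)
Definition flat_piece p nu S : Prop :=
  [/\ enorm nu = 1, S `<=` hyperplane p nu & measurable S].

(* The segment [x, y] goes from one side of the hyperplane to the other, and it
   does so through S. Segments having an end point on the hyperplane are not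
   counted; the corresponding pairs (x, y) are Lebesgue negligible. *)
Definition crosses p nu S x y : Prop :=
  dotp nu (x - p) * dotp nu (y - p) < 0 /\
  exists2 s : R, 0 <= s <= 1 & S (x + s *: (y - x)).

End euclidean.

Section hausdorff.
Context {R : realType}.

(* omega_n, the volume of the unit ball of R^n *)
Definition unit_ball_volume n : R := fine (lebesgue_rV n (horizon 1 0)).

(* Coverings of S by countably many sets of diameter at most delta *)
Definition small_cover n (delta : R) (S : set 'rV[R]_n) :
    set (nat -> set 'rV[R]_n) :=
  [set U | (forall i, (ediam (U i) <= delta%:E)%E) /\ S `<=` \bigcup_i U i].

(* k-dimensional Hausdorff (outer) measure, for k > 0, with the normalization
   omega_k / 2 ^ k that makes it agree with Lebesgue measure when k = n. *)
Definition hausdorff_pre n (k : nat) (delta : R) (S : set 'rV[R]_n) : \bar R :=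
  ereal_inf
    [set (\sum_(0 <= i <oo)
            (unit_ball_volume k / 2 ^+ k)%:E * ediam (U i) ^+ k)%E
      | U in small_cover delta S].

Definition hausdorff_measure n (k : nat) (S : set 'rV[R]_n) : \bar R :=
  ereal_sup [set hausdorff_pre k delta S | delta in [set delta : R | 0 < delta]].

End hausdorff.

Section peridynamics.
Context {R : realType} {d : nat}.
Implicit Types (x y p nu : 'rV[R]_d) (Omega S : set 'rV[R]_d).

(* Only the values of J on [0, +oo[ are meaningful. *)
Definition influence_function (J : R -> R) (M : R) : Prop :=
  [/\ forall r, 0 <= r -> 0 <= J r,
      forall r s, 0 <= r -> r <= s -> J s <= J r,
      forall r, 0 <= r < 1 -> 0 < J r,
      J 0 = M &
      forall r, 1 <= r -> J r = 0].

Definition rho Omega (J : R -> R) (eps : R) y x : R :=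
  \1_Omega y * J (enorm (y - x) / eps) / (eps * unit_ball_volume d * eps ^+ d).

(* chi^+(y, x, t), where Gamma t is the set of pairs (x, y) whose bond is
   broken by time t *)
Definition chi_plus (Gamma : R -> set ('rV[R]_d * 'rV[R]_d)) y x (t : R) : R :=
  \1_(Gamma t) (x, y).

Definition failure_energy Omega (J : R -> R) (Cp eps : R)
    (Gamma : R -> set ('rV[R]_d * 'rV[R]_d)) (t : R) : \bar R :=
  (\int[lebesgue_rV d]_(x in Omega) \int[lebesgue_rV d]_(y in Omega)
    (rho Omega J eps y x * Cp * chi_plus Gamma y x t)%:E)%E.

Definition critical_energy_release_rate (J : R -> R) (Cp : R) : R :=
  Cp * (2 * unit_ball_volume d.-1 / unit_ball_volume d) *
  \int[lebesgue_measure]_(q in `[0, 1]) (q ^+ d * J q).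

(* The bonds broken by the flat crack S, which lies in the hyperplane through p
   with normal nu. *)
Definition flat_crack_bonds Omega (eps : R) p nu S :
    set ('rV[R]_d * 'rV[R]_d) :=
  [set z | [/\ Omega z.1, (Omega `&` horizon eps z.1) z.2 &
               crosses p nu S z.1 z.2]].

End peridynamics.

Arguments critical_energy_release_rate {R} d J Cp.

(* Main.v *)
From HB Require Import structures.
Require Import Defs.
From mathcomp Require Import all_boot all_order all_algebra fingroup perm ring lra.
From mathcomp Require Import all_classical all_reals all_analysis measurable_realfun.

Set Implicit Arguments.
Unset Strict Implicit.
Unset Printing Implicit Defensive.

Import Order.TTheory GRing.Theory Num.Theory.
Import numFieldTopology.Exports numFieldNormedType.Exports.

Local Open Scope classical_set_scope.
Local Open Scope ring_scope.

(* The bond energy depends on a pair (x, y) only through xi = y - x and through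
   whether [x, y] crosses the crack S.  Shifting y by x and exchanging the
   integrals leaves, for each xi, the volume of the set of x such that
   [x, x + xi] crosses S: an oblique cylinder of volume |nu . xi| |S|.  What
   remains is |S| times the integral of J(|xi| / eps) |nu . xi|, which after a
   rotation and a scaling is a one-dimensional integral: on a line at distance
   rho from the origin, t dt = u du with u = sqrt(t^2 + rho^2), and J, which is
   only monotone, is reduced to indicators of its level sets.

   The area |S| is first obtained as the Lebesgue measure of S in isometric
   coordinates of the hyperplane.  It is the Hausdorff measure because of the
   isodiametric inequality (Steiner symmetrization) in one direction, and of a
   covering argument in the other one: if Hausdorff premeasures are bounded by
   (1 + C) times Lebesgue measure, then covering a small cube by its inscribed
   ball and the rest improves C by a fixed factor < 1. *)

(** * Measurability and the Euclidean norm *)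

(** The assumption that the [eps]-ball about each crack point lies in [Omega] removes [Omega] from
    the problem: a broken bond has both ends within [eps] of the point where it meets the crack, so
    the energy is an integral over the whole space, where translations, rotations and dilations act.
    Closer to the boundary some of these bonds would be missing and the equality could fail.

    Lebesgue measure is an iterated product, so translations and dilations are handled coordinate by
    coordinate, but rotations mix the coordinates. Their invariance is obtained by comparing every
    set with the unit ball, which is visibly invariant.

    In the covering argument the fixed factor is [1 - c], where [c] is the share of a cube filled by
    its inscribed ball. Since [c] is also the normalization constant of Hausdorff measure and the
    ball has the side of the cube as diameter, the ball is charged no more than its volume, and all
    excess comes from the remaining share [1 - c]. Both inequalities hold for each premeasure with
    [delta > 0], so no limit in [delta] has to be studied. *)

Section measurability.
Context {R : realType} d (T : measurableType d).

Lemma measurable_funV (f : T -> R) :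
  measurable_fun setT f -> measurable_fun setT (fun x => (f x)^-1).
Proof.
(* The power with exponent -1 is the inverse only on nonnegative bases, hence the square. Where [f]
   vanishes both sides are 0. *)
move=> mf; rewrite (_ : (fun _ => _) = fun x => f x * ((f x ^+ 2) `^ (-1))).
  apply: measurable_funM => //.
  by apply: (measurableT_comp (measurable_powR (-1))); exact: measurable_funX.
apply/funext => x; rewrite powR_inv1 ?sqr_ge0//.
have [->|fx0] := eqVneq (f x) 0; first by rewrite invr0 mul0r.
by field.
Qed.

Lemma measurable_fun_sqrt (f : T -> R) :
  measurable_fun setT f -> measurable_fun setT (fun x => Num.sqrt (f x)).
Proof.
move=> mf; rewrite (_ : (fun _ => _) = fun x => (Num.max (f x) 0) `^ 2^-1).
  apply: (measurableT_comp (measurable_powR 2^-1)).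
  exact: measurable_maxr.
apply/funext => x; have [fx|fx] := leP (f x) 0.
  by rewrite ler0_sqrtr// powR0// invr_eq0 pnatr_eq0.
by rewrite powR12_sqrt// ltW.
Qed.

Lemma measurable_coordP n (f : T -> 'rV[R]_n) :
  measurable_fun setT f <->
  forall i, measurable_fun setT (fun x => f x ord0 i).
Proof.
split=> [mf i|mf]; first exact: measurableT_comp (measurable_rV_coord i) mf.
exact: measurable_fun_rV.
Qed.

Lemma measurable_rVD n (f g : T -> 'rV[R]_n) :
  measurable_fun setT f -> measurable_fun setT g ->
  measurable_fun setT (fun x => f x + g x).
Proof.
move=> /measurable_coordP mf /measurable_coordP mg; apply/measurable_coordP => i.
under eq_fun do rewrite mxE.
exact: measurable_funD.
Qed.

Lemma measurable_rVZ n (a : T -> R) (f : T -> 'rV[R]_n) :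
  measurable_fun setT a -> measurable_fun setT f ->
  measurable_fun setT (fun x => a x *: f x).
Proof.
move=> ma /measurable_coordP mf; apply/measurable_coordP => i.
under eq_fun do rewrite mxE.
exact: measurable_funM.
Qed.

Lemma measurable_rVN n (f : T -> 'rV[R]_n) :
  measurable_fun setT f -> measurable_fun setT (fun x => - f x).
Proof.
move=> mf; under eq_fun do rewrite -scaleN1r.
exact: measurable_rVZ.
Qed.

Lemma measurable_rVB n (f g : T -> 'rV[R]_n) :
  measurable_fun setT f -> measurable_fun setT g ->
  measurable_fun setT (fun x => f x - g x).
Proof. by move=> mf mg; apply: measurable_rVD => //; exact: measurable_rVN. Qed.

Lemma measurable_rV_mulmx m n (f : T -> 'rV[R]_m) (A : 'M[R]_(m, n)) :
  measurable_fun setT f -> measurable_fun setT (fun x => f x *m A).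
Proof.
move=> /measurable_coordP mf; apply/measurable_coordP => i.
under eq_fun do rewrite mxE.
by apply: measurable_sum => j; exact: measurable_funM.
Qed.

Lemma measurable_dotp n (f g : T -> 'rV[R]_n) :
  measurable_fun setT f -> measurable_fun setT g ->
  measurable_fun setT (fun x => dotp (f x) (g x)).
Proof.
move=> /measurable_coordP mf /measurable_coordP mg.
by apply: measurable_sum => i; exact: measurable_funM.
Qed.

Lemma measurable_enorm n (f : T -> 'rV[R]_n) :
  measurable_fun setT f -> measurable_fun setT (fun x => enorm (f x)).
Proof. by move=> mf; apply: measurable_fun_sqrt; exact: measurable_dotp. Qed.

Lemma measurable_rV_consf n (a : T -> R) (f : T -> 'rV[R]_n) :
  measurable_fun setT a -> measurable_fun setT f ->
  measurable_fun setT (fun x => rV_cons (a x, f x)).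
Proof.
move=> ma mf; apply: (measurableT_comp (@measurable_rV_cons R n)).
exact: measurable_fun_pair.
Qed.

End measurability.

(** * Euclidean norm, and splitting off the first coordinate *)

Section euclidean_norm.
Context {R : realType}.
Implicit Types n : nat.

Lemma dotpE n (u v : 'rV[R]_n) : dotp u v = (u *m v^T) ord0 ord0.
Proof. by rewrite mxE; apply: eq_bigr => i _; rewrite mxE. Qed.

Lemma dotpC n (u v : 'rV[R]_n) : dotp u v = dotp v u.
Proof. by apply: eq_bigr => i _; rewrite mulrC. Qed.

Lemma dotpDl n (u v w : 'rV[R]_n) : dotp (u + v) w = dotp u w + dotp v w.
Proof. by rewrite -big_split; apply: eq_bigr => i _; rewrite mxE mulrDl. Qed.

Lemma dotpZl n a (u w : 'rV[R]_n) : dotp (a *: u) w = a * dotp u w.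
Proof. by rewrite /dotp mulr_sumr; apply: eq_bigr => i _; rewrite mxE mulrA. Qed.

Lemma dotpDr n (u v w : 'rV[R]_n) : dotp w (u + v) = dotp w u + dotp w v.
Proof. by rewrite dotpC dotpDl !(dotpC w). Qed.

Lemma dotpZr n a (u w : 'rV[R]_n) : dotp w (a *: u) = a * dotp w u.
Proof. by rewrite dotpC dotpZl (dotpC w). Qed.

Lemma dotpNr n (u w : 'rV[R]_n) : dotp w (- u) = - dotp w u.
Proof. by rewrite -scaleN1r dotpZr mulN1r. Qed.

Lemma dotp0r n (u : 'rV[R]_n) : dotp u 0 = 0.
Proof. by rewrite -(scale0r (0 : 'rV[R]_n)) dotpZr mul0r. Qed.

Lemma dotp_ge0 n (u : 'rV[R]_n) : 0 <= dotp u u.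
Proof. by apply: sumr_ge0 => i _; rewrite -expr2 sqr_ge0. Qed.

Lemma dotp_eq0 n (u : 'rV[R]_n) : dotp u u = 0 -> u = 0.
Proof.
move=> /eqP; rewrite psumr_eq0 => [/allP u0|i _]; last by rewrite -expr2 sqr_ge0.
apply/rowP => i; rewrite mxE; apply/eqP.
by have := u0 i (mem_index_enum i); rewrite /= mulf_eq0 orbb.
Qed.

Lemma enorm_ge0 n (u : 'rV[R]_n) : 0 <= enorm u.
Proof. exact: sqrtr_ge0. Qed.

Lemma enorm_sqr n (u : 'rV[R]_n) : enorm u ^+ 2 = dotp u u.
Proof. by rewrite sqr_sqrtr// dotp_ge0. Qed.

Lemma enormZ n a (u : 'rV[R]_n) : enorm (a *: u) = `|a| * enorm u.
Proof.
rewrite /enorm dotpZl dotpZr mulrA -expr2 sqrtrM ?sqr_ge0//.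
by rewrite sqrtr_sqr.
Qed.

Lemma enorm0 n : enorm (0 : 'rV[R]_n) = 0.
Proof. by rewrite -(scale0r (0 : 'rV[R]_n)) enormZ normr0 mul0r. Qed.

Lemma enormN n (u : 'rV[R]_n) : enorm (- u) = enorm u.
Proof. by rewrite -scaleN1r enormZ normrN1 mul1r. Qed.

Lemma enormBC n (u v : 'rV[R]_n) : enorm (u - v) = enorm (v - u).
Proof. by rewrite -enormN opprB. Qed.

Lemma dotp_le_enorm n (u v : 'rV[R]_n) : dotp u v <= enorm u * enorm v.
Proof.
have [u0|u0] := eqVneq (enorm u) 0.
  have /dotp_eq0-> : dotp u u = 0 by rewrite -enorm_sqr u0 expr0n.
  by rewrite dotpC dotp0r enorm0 mul0r.
have un : 0 < enorm u by rewrite lt_neqAle eq_sym u0 enorm_ge0.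
have [v0|v0] := eqVneq (enorm v) 0.
  have /dotp_eq0-> : dotp v v = 0 by rewrite -enorm_sqr v0 expr0n.
  by rewrite dotp0r enorm0 mulr0.
have vn : 0 < enorm v by rewrite lt_neqAle eq_sym v0 enorm_ge0.
(* This square expands to [2 |u| |v| (|u| |v| - u . v)], and the first factors are positive. *)
have := dotp_ge0 (enorm v *: u - enorm u *: v).
rewrite dotpDl !dotpDr -!scaleNr !dotpZl !dotpZr -!enorm_sqr (dotpC v u).
rewrite (_ : _ + _ = (2 * (enorm u * enorm v)) *
    (enorm u * enorm v - dotp u v)); last by ring.
by rewrite pmulr_rge0 ?subr_ge0// !mulr_gt0.
Qed.

Lemma enormD n (u v : 'rV[R]_n) : enorm (u + v) <= enorm u + enorm v.
Proof.
rewrite -(@ler_pXn2r _ 2%N)// ?nnegrE ?addr_ge0 ?enorm_ge0//.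
rewrite enorm_sqr dotpDl !dotpDr (dotpC v u) sqrrD -!enorm_sqr.
have := dotp_le_enorm u v; lra.
Qed.

Lemma enormB_trans n (v u w : 'rV[R]_n) :
  enorm (u - w) <= enorm (u - v) + enorm (v - w).
Proof. by rewrite (le_trans _ (enormD _ _))// addrA subrK. Qed.

Lemma coord_le_enorm n (u : 'rV[R]_n) i : `|u ord0 i| <= enorm u.
Proof.
rewrite -sqrtr_sqr ler_sqrt ?dotp_ge0// /dotp (bigD1 i)//= expr2 lerDl.
by apply: sumr_ge0 => j _; rewrite -expr2 sqr_ge0.
Qed.

Lemma enorm_le_sum n (u : 'rV[R]_n) : enorm u <= \sum_i `|u ord0 i|.
Proof.
rewrite -(@ler_pXn2r _ 2%N)// ?nnegrE ?enorm_ge0 ?sumr_ge0//.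
rewrite enorm_sqr expr2 /dotp mulr_suml; apply: ler_sum => i _.
apply: (@le_trans _ _ (`|u ord0 i| * `|u ord0 i|)).
  by rewrite -!expr2 real_normK ?num_real.
by rewrite ler_wpM2l// (bigD1 i)//= lerDl sumr_ge0.
Qed.

Lemma enorm_le_bound n (u : 'rV[R]_n) c :
  (forall i, `|u ord0 i| <= c) -> enorm u <= c *+ n.
Proof.
move=> uc; rewrite (le_trans (enorm_le_sum u))//.
by rewrite (le_trans (ler_sum _ (fun i _ => uc i)))// sumr_const card_ord.
Qed.

Lemma rV_cons_coord0 n t (v : 'rV[R]_n) : rV_cons (t, v) ord0 ord0 = t.
Proof. by have := congr1 fst (rV_consK (t, v)). Qed.

Lemma rV_cons_lift n t (v : 'rV[R]_n) i :
  rV_cons (t, v) ord0 (lift ord0 i) = v ord0 i.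
Proof.
rewrite (_ : lift ord0 i = rshift 1 i); last exact: val_inj.
by rewrite /rV_cons /= (@row_mxEr _ 1 1 n).
Qed.

Lemma dotp_cons n s t (u v : 'rV[R]_n) :
  dotp (rV_cons (s, u)) (rV_cons (t, v)) = s * t + dotp u v.
Proof.
rewrite /dotp big_ord_recl !rV_cons_coord0; congr (_ + _).
by apply: eq_bigr => i _; rewrite !rV_cons_lift.
Qed.

Lemma enorm_cons n t (v : 'rV[R]_n) :
  enorm (rV_cons (t, v)) = Num.sqrt (t ^+ 2 + enorm v ^+ 2).
Proof. by rewrite enorm_sqr {1}/enorm dotp_cons expr2. Qed.

Lemma eq_rV_cons n (u v : 'rV[R]_n.+1) : u ord0 ord0 = v ord0 ord0 ->
  (forall i, u ord0 (lift ord0 i) = v ord0 (lift ord0 i)) -> u = v.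
Proof. by move=> uv0 uv; apply/rowP => i; case: (unliftP ord0 i) => [j|] ->. Qed.

Lemma rV_consD n s t (u v : 'rV[R]_n) :
  rV_cons (s, u) + rV_cons (t, v) = rV_cons (s + t, u + v).
Proof.
by apply: eq_rV_cons => [|i]; rewrite mxE !(rV_cons_coord0, rV_cons_lift) ?mxE.
Qed.

Lemma rV_consZ n a t (v : 'rV[R]_n) :
  a *: rV_cons (t, v) = rV_cons (a * t, a *: v).
Proof.
by apply: eq_rV_cons => [|i]; rewrite mxE !(rV_cons_coord0, rV_cons_lift) ?mxE.
Qed.

Lemma rV_consB n s t (u v : 'rV[R]_n) :
  rV_cons (s, u) - rV_cons (t, v) = rV_cons (s - t, u - v).
Proof. by rewrite -[in LHS]scaleN1r rV_consZ rV_consD mulN1r scaleN1r. Qed.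

Lemma rV_unconsK n : cancel (@rV_uncons R n) (@rV_cons R n).
Proof.
move=> v; apply: eq_rV_cons => [|i]; rewrite ?rV_cons_coord0 ?rV_cons_lift//.
by rewrite mxE; congr (v _ _); exact: val_inj.
Qed.

Lemma rV_consP n (v : 'rV[R]_n.+1) : exists t w, v = rV_cons (t, w).
Proof.
by exists (rV_uncons v).1, (rV_uncons v).2; rewrite -{1}(rV_unconsK v); case: rV_uncons.
Qed.

End euclidean_norm.

(** * Lebesgue measure on row vectors *)

Section lebesgue_product.
Context {R : realType}.
Implicit Types n : nat.
Local Open Scope ereal_scope.

Lemma lebesgue_rV_fubini1 n (f : 'rV[R]_n.+1 -> \bar R) :
  measurable_fun setT f -> (forall x, 0 <= f x) ->
  \int[lebesgue_rV n.+1]_x f x =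
  \int[lebesgue_measure]_t \int[lebesgue_rV n]_v f (rV_cons (t, v)).
Proof.
move=> mf f0; rewrite (@ge0_integral_pushforward _ _ _ _ R _
  (@measurable_rV_cons R n) (lebesgue_measure \x lebesgue_rV n))//.
rewrite preimage_setT fubini_tonelli1//; last by move=> x; exact: f0.
by apply: measurableT_comp => //; exact: measurable_rV_cons.
Qed.

Lemma lebesgue_rV_fubini2 n (f : 'rV[R]_n.+1 -> \bar R) :
  measurable_fun setT f -> (forall x, 0 <= f x) ->
  \int[lebesgue_rV n.+1]_x f x =
  \int[lebesgue_rV n]_v \int[lebesgue_measure]_t f (rV_cons (t, v)).
Proof.
move=> mf f0; rewrite lebesgue_rV_fubini1//.
apply: (@fubini_tonelli _ _ _ _ R lebesgue_measure (lebesgue_rV n)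
  (fun z => f (rV_cons z))) => //.
by apply: measurableT_comp => //; exact: measurable_rV_cons.
Qed.

Lemma measurable_indicE d (T : measurableType d) (A : set T) :
  measurable A -> measurable_fun setT (fun x => (\1_A x : R)%:E).
Proof. by move=> mA; apply/measurable_EFinP; exact: measurable_indic. Qed.

Lemma measure_integral_indic d (T : measurableType d)
    (mu : {measure set T -> \bar R}) A : measurable A ->
  mu A = \int[mu]_x (\1_A x)%:E.
Proof. by move=> mA; rewrite integral_indic// setIT. Qed.

Lemma measurable_preimage d d' (T : measurableType d) (T' : measurableType d')
  (f : T -> T') A : measurable_fun setT f -> measurable A -> measurable (f @^-1` A).
Proof. by move=> mf mA; rewrite -[X in measurable X]setTI; exact: mf. Qed.

(** The scaled pushforward is again a measure, and Lebesgue measure is determined by its values on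
    the intervals []c, d]]. For negative [a] the preimage of such an interval is closed on the left
    instead. *)
Lemma lebesgue_measure_affine (a b : R) A : a != 0%R -> measurable A ->
  (`|a|%:E * lebesgue_measure ((fun x => a * x + b)%R @^-1` A) =
   lebesgue_measure A).
Proof.
move=> a0 mA.
have mf : measurable_fun setT (fun x : measurableTypeR R => (a * x + b)%R : measurableTypeR R).
  by apply: measurable_funD => //; apply: measurable_funM.
apply/esym; apply: (@lebesgue_measure_unique R (mscale (NngNum (normr_ge0 a))
  (measure_function_pushforward__canonical__measure_function_Measure
    lebesgue_measure mf))) => //.
move=> _ [[c d] _ <-]; transitivity
  (`|a|%:E * lebesgue_measure ((fun x => a * x + b)%R @^-1` `]c, d]%classic)) => //.
have [a_gt0|a_lt0|a00] := ltgtP a 0%R; last by rewrite a00 eqxx in a0.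
- rewrite (_ : _ @^-1` _ = `[(d - b) / a, (c - b) / a[%classic)%R; last first.
    apply/seteqP; split => x /=; rewrite !in_itv/= ler_ndivrMr// ltr_ndivlMr//;
    rewrite mulrC => /andP[h1 h2]; apply/andP; split; lra.
  rewrite !lebesgue_measure_itv/= !lte_fin ltr_ndivlMr// divfK//.
  rewrite ltrD2r; case: ifPn => _; last by rewrite mule0.
  rewrite -!EFinD -EFinM; congr EFin; rewrite ltr0_norm//; field.
  by [].
- rewrite (_ : _ @^-1` _ = `](c - b) / a, (d - b) / a]%classic)%R; last first.
    apply/seteqP; split => x /=; rewrite !in_itv/= ltr_pdivrMr// ler_pdivlMr//;
    rewrite mulrC => /andP[h1 h2]; apply/andP; split; lra.
  rewrite !lebesgue_measure_itv/= !lte_fin ltr_pdivlMr// divfK//.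
  rewrite ltrD2r; case: ifPn => _; last by rewrite mule0.
  rewrite -!EFinD -EFinM; congr EFin; rewrite gtr0_norm//; field.
  by [].
Qed.

Lemma ge0_integral_affine1 (a b : R) (f : measurableTypeR R -> \bar R) :
  a != 0%R -> measurable_fun setT f -> (forall x, 0 <= f x) ->
  `|a|%:E * \int[lebesgue_measure]_x f (a * x + b)%R =
  \int[lebesgue_measure]_x f x.
Proof.
move=> a0 mf f0.
have mg : measurable_fun setT (fun x : measurableTypeR R => (a * x + b)%R : measurableTypeR R).
  by apply: measurable_funD => //; apply: measurable_funM.
have := @ge0_integral_pushforward _ _ _ _ R _ mg lebesgue_measure setT f
  measurableT mf (fun x _ => f0 x).
rewrite preimage_setT => <-.
rewrite -[X in X%:E * _]/((NngNum (normr_ge0 a))%:num)%R -ge0_integral_mscale//.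
apply: eq_measure_integral => A mA _.
exact: lebesgue_measure_affine.
Qed.

Lemma ge0_integral_affine n (a : R) (b : 'rV[R]_n) (f : 'rV[R]_n -> \bar R) :
  a != 0%R -> measurable_fun setT f -> (forall x, 0 <= f x) ->
  (`|a| ^+ n)%:E * \int[lebesgue_rV n]_x f (a *: x + b)%R =
  \int[lebesgue_rV n]_x f x.
Proof.
move=> a0; elim: n b f => [|n IH] b f mf f0.
  rewrite expr0 mul1e; apply: eq_integral => x _.
  by congr f; rewrite (thinmx0 x) (thinmx0 (_ + _)%R).
have maff : measurable_fun setT (fun x : 'rV[R]_n.+1 => a *: x + b)%R.
  by apply: measurable_rVD => //; exact: measurable_rVZ.
rewrite lebesgue_rV_fubini1//; last exact: measurableT_comp.
rewrite lebesgue_rV_fubini1//.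
have mfc (t : R) : measurable_fun setT (fun v : 'rV_n => f (rV_cons (t, v))).
  by apply: measurableT_comp => //; exact: measurable_rV_consf.
have mF : measurable_fun setT (fun t => \int[lebesgue_rV n]_v f (rV_cons (t, v))).
  apply: (@measurable_fun_fubini_tonelli_F _ _ _ _ R (lebesgue_rV n)
    (fun z => f (rV_cons z))) => //.
  by apply: measurableT_comp => //; exact: measurable_rV_cons.
have F0 t : 0 <= \int[lebesgue_rV n]_v f (rV_cons (t, v)) by exact: integral_ge0.
rewrite -[RHS](ge0_integral_affine1 (b ord0 ord0) a0 mF F0).
rewrite exprS EFinM -muleA; congr (_ * _).
have [t0 [b' bE]] := rV_consP b.
rewrite -ge0_integralZl//; last 2 first.
- apply: (@measurable_fun_fubini_tonelli_F _ _ _ _ R (lebesgue_rV n)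
    (fun z => f (a *: rV_cons z + b)%R)) => //.
  apply: measurableT_comp => //.
  apply: measurable_rVD => //; apply: measurable_rVZ => //.
  exact: measurable_rV_cons.
- by move=> t _; exact: integral_ge0.
apply: eq_integral => t _.
rewrite -[RHS](IH b')//; congr (_ * _).
apply: eq_integral => v _; congr f.
by rewrite rV_consZ bE rV_consD rV_cons_coord0.
Qed.

End lebesgue_product.

(** * Volumes of boxes and balls, invariance under isometries *)

Section lebesgue_invariance.
Context {R : realType}.
Implicit Types n : nat.
Local Open Scope ereal_scope.

Lemma lebesgue_rV_affine n (a : R) (b : 'rV[R]_n) A :
  a != 0%R -> measurable A ->
  (`|a| ^+ n)%:E * lebesgue_rV n [set x | A (a *: x + b)%R] = lebesgue_rV n A.
Proof.
move=> a0 mA; rewrite [RHS]measure_integral_indic//.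
rewrite -(@ge0_integral_affine R n a b)//; last exact: measurable_indicE.
rewrite measure_integral_indic; first by [].
apply: measurable_preimage => //.
by apply: measurable_rVD => //; exact: measurable_rVZ.
Qed.

Lemma ge0_integral_shift n (b : 'rV[R]_n) (f : 'rV[R]_n -> \bar R) :
  measurable_fun setT f -> (forall x, 0 <= f x) ->
  \int[lebesgue_rV n]_x f (x + b)%R = \int[lebesgue_rV n]_x f x.
Proof.
move=> mf f0; rewrite -[RHS](@ge0_integral_affine R n 1 b)// ?oner_neq0//.
rewrite normr1 expr1n mul1e; apply: eq_integral => x _.
by rewrite scale1r.
Qed.

Lemma measurable_horizon n (r : R) (x : 'rV[R]_n) : measurable (horizon r x).
Proof.
rewrite /horizon (_ : mkset _ = (fun y => enorm (y - x)) @^-1` `]-oo, r[%classic).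
  apply: measurable_preimage => //; apply: measurable_enorm.
  exact: measurable_rVB.
by apply/seteqP; split => y /=; rewrite in_itv.
Qed.

(** Half-open, so that a cut along a coordinate hyperplane leaves two boxes and translated cubes
    tile the space. *)
Definition box n (a b : 'rV[R]_n) : set 'rV[R]_n :=
  [set x | forall i, (a ord0 i <= x ord0 i < b ord0 i)%R].

Lemma measurable_box n (a b : 'rV[R]_n) : measurable (box a b).
Proof.
rewrite (_ : box a b = \bigcap_(i in [set: 'I_n])
    (@rV_coord R n i @^-1` `[a ord0 i, b ord0 i[%classic)).
  apply: fin_bigcap_measurable => // i _.
  by apply: measurable_preimage => //; exact: measurable_rV_coord.
apply/seteqP; split => x /=; first by move=> xab i _; rewrite /= in_itv/=; exact: xab.
by move=> xab i; have := xab i I; rewrite /= in_itv.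
Qed.

Lemma lebesgue_rV_box n (a b : 'rV[R]_n) :
  (forall i, a ord0 i <= b ord0 i)%R ->
  lebesgue_rV n (box a b) = (\prod_i (b ord0 i - a ord0 i))%:E.
Proof.
elim: n a b => [|n IH] a b ab.
  by rewrite big_ord0 [LHS]diracE mem_set// => -[].
have [s [u aE]] := rV_consP a; have [t [v bE]] := rV_consP b.
rewrite [LHS](_ : _ = (lebesgue_measure \x lebesgue_rV n) (`[s, t[ `*` box u v)).
  rewrite product_measure1E//; last exact: measurable_box.
  rewrite big_ord_recl; have := ab ord0.
  rewrite {1 2}aE {1 2}bE !rV_cons_coord0 => st.
  rewrite [X in X * _ = _](_ : _ = (t - s)%:E); last first.
    apply: etrans (lebesgue_measure_itv `[s, t[) _; rewrite /= lte_fin.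
    by move: st; rewrite le_eqVlt => /orP[/eqP->|->//]; rewrite ltxx subrr.
  rewrite IH; last first.
    by move=> i; have := ab (lift ord0 i); rewrite aE bE !rV_cons_lift.
  rewrite EFinM; congr (_ * _%:E).
  by apply: eq_bigr => i _; rewrite aE bE !rV_cons_lift.
rewrite (_ : `[s, t[ `*` box u v = @rV_cons R n @^-1` box a b)//.
apply/esym/seteqP; split => -[x w]/= => [xw|].
  split.
    by have := xw ord0; rewrite aE bE !rV_cons_coord0 in_itv.
  by move=> i; have := xw (lift ord0 i); rewrite aE bE !rV_cons_lift.
rewrite in_itv/= => -[xst wuv] i; case: (unliftP ord0 i) => [j|] ->.
  by rewrite aE bE !rV_cons_lift; exact: wuv.
by rewrite aE bE !rV_cons_coord0.
Qed.

Lemma horizonS n (r : R) (x : 'rV[R]_n) : (0 < r)%R ->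
  horizon r x = [set y | horizon 1 0 (r^-1 *: y - r^-1 *: x)%R].
Proof.
move=> r0; apply/seteqP; split => y; rewrite /horizon/= subr0 -scalerBr enormZ;
  by rewrite gtr0_norm ?invr_gt0// mulrC ltr_pdivrMr// mul1r.
Qed.

Lemma lebesgue_horizon_fin n : lebesgue_rV n (horizon 1 (0 : 'rV[R]_n)) \is a fin_num.
Proof.
rewrite ge0_fin_numE//.
apply: (@le_lt_trans _ _ (lebesgue_rV n (@box n (const_mx (-1)%R) (const_mx 1%R)))).
  apply: le_measure; rewrite ?inE; [exact: measurable_horizon|exact: measurable_box|].
  move=> x; rewrite /horizon/= subr0 => x1 i; rewrite !mxE.
  have := le_lt_trans (coord_le_enorm x i) x1.
  by rewrite ltr_norml => /andP[/ltW-> ->].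
rewrite lebesgue_rV_box ?ltry// => i; rewrite !mxE; lra.
Qed.

Lemma unit_ball_volumeE n :
  (unit_ball_volume n : R)%:E = lebesgue_rV n (horizon 1 0).
Proof. by rewrite fineK// lebesgue_horizon_fin. Qed.

Lemma unit_ball_volume_gt0 n : (0 < unit_ball_volume n :> R)%R.
Proof.
rewrite -lte_fin unit_ball_volumeE.
(* On the cube [[0, c)^n] the norm is at most [n c = n / (n + 1) < 1]; the successor also covers
   [n = 0]. *)
pose c : R := (n.+1%:R^-1)%R.
have c0 : (0 < c)%R by rewrite invr_gt0.
apply: (@lt_le_trans _ _ (lebesgue_rV n (box 0 (const_mx c)))).
  rewrite lebesgue_rV_box => [|i]; last by rewrite !mxE ltW.
  by rewrite lte_fin prodr_gt0// => i _; rewrite !mxE subr0.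
apply: le_measure; rewrite ?inE; [exact: measurable_box|exact: measurable_horizon|].
move=> x xc; rewrite /horizon/= subr0.
apply: (@le_lt_trans _ _ (c *+ n)%R); last first.
  by rewrite -mulr_natr mulrC ltr_pdivrMr// mul1r ltr_nat.
apply: enorm_le_bound => i; have := xc i; rewrite !mxE => /andP[x0 /ltW xc'].
by rewrite ger0_norm.
Qed.

Lemma lebesgue_horizon n (r : R) (x : 'rV[R]_n) : (0 < r)%R ->
  lebesgue_rV n (horizon r x) = (unit_ball_volume n * r ^+ n)%:E.
Proof.
move=> r0; rewrite (horizonS _ r0).
have ri0 : (r^-1 != 0)%R by rewrite invr_eq0 gt_eqF.
have := @lebesgue_rV_affine n (r^-1) (- (r^-1 *: x))%R _ ri0 (measurable_horizon 1 0).
rewrite -unit_ball_volumeE gtr0_norm ?invr_gt0// => /(congr1 (fun y => (r ^+ n)%:E * y)).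
rewrite muleA -EFinM -exprMn mulfV ?gt_eqF// expr1n mul1e => ->.
by rewrite -EFinM mulrC.
Qed.

(** The unit ball [B] is invariant because [O] preserves the norm. The product of the left side with
    [|B|] is the double integral of [1_A(x O) 1_B(y + x O)]. Exchanging the integrals and replacing
    [x] by [x - y O^T] turns the integrand into [1_A(x O - y) 1_B(x O)], whose integral over [y] is
    [|A| 1_B(x)]. Only Tonelli, translations and [y] to [- y] are used; at the end [|B|], finite and
    positive, cancels. *)
Lemma lebesgue_rV_orthogonal n (O : 'M[R]_n) A : O *m O^T = 1%:M ->
  measurable A -> lebesgue_rV n [set x | A (x *m O)] = lebesgue_rV n A.
Proof.
move=> OO mA.
have OtO : O^T *m O = 1%:M by exact: mulmx1C.
pose B := horizon 1 (0 : 'rV[R]_n).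
have mB : measurable B by exact: measurable_horizon.
have BO x : B (x *m O) = B x.
  by rewrite /B /horizon/= !subr0 /enorm !dotpE trmx_mul -mulmxA (mulmxA O) OO mul1mx.
have m1 (C : set 'rV[R]_n) (f : 'rV[R]_n * 'rV[R]_n -> 'rV[R]_n) : measurable C ->
    measurable_fun setT f -> measurable_fun setT (fun z => (\1_C (f z) : R)%:E).
  move=> mC mf.
  by apply: (measurableT_comp (measurable_indicE mC)).
have m1' (C : set 'rV[R]_n) (f : 'rV[R]_n -> 'rV[R]_n) : measurable C ->
    measurable_fun setT f -> measurable_fun setT (fun z => (\1_C (f z) : R)%:E).
  move=> mC mf.
  by apply: (measurableT_comp (measurable_indicE mC)).
have mO : measurable_fun setT (fun x : 'rV[R]_n => x *m O).
  exact: measurable_rV_mulmx.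
have i0 (C : set 'rV[R]_n) x : 0 <= (\1_C x : R)%:E by rewrite lee_fin.
suff : lebesgue_rV n [set x | A (x *m O)] * lebesgue_rV n B =
       lebesgue_rV n A * lebesgue_rV n B.
  rewrite -unit_ball_volumeE => /(congr1 (fun y => y * (unit_ball_volume n)^-1%:E)).
  by rewrite -!muleA -!EFinM mulfV ?gt_eqF ?unit_ball_volume_gt0// !mule1.
transitivity (\int[lebesgue_rV n]_x \int[lebesgue_rV n]_y
    ((\1_A (x *m O))%:E * (\1_B (y + x *m O))%:E)).
  rewrite [X in X * _ = _]measure_integral_indic; last exact: measurable_preimage.
  rewrite -ge0_integralZr//; last by apply: measurable_indicE; exact: measurable_preimage.
  apply: eq_integral => x _.
  rewrite [X in _ * X]measure_integral_indic//.
  have mBx : measurable_fun setT (fun y : 'rV[R]_n => (\1_B (y + x *m O) : R)%:E).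
    by apply: m1' => //; exact: measurable_rVD.
  rewrite (ge0_integralZl _ measurableT mBx (fun y _ => i0 B _) (i0 A _)).
  rewrite (@ge0_integral_shift n (x *m O) (fun y => (\1_B y : R)%:E))//.
  exact: measurable_indicE.
transitivity (\int[lebesgue_rV n]_y \int[lebesgue_rV n]_x
    ((\1_A (x *m O))%:E * (\1_B (y + x *m O))%:E)).
  apply: (@fubini_tonelli _ _ _ _ R (lebesgue_rV n) (lebesgue_rV n)
    (fun z => (\1_A (z.1 *m O))%:E * (\1_B (z.2 + z.1 *m O))%:E)).
    apply: emeasurable_funM; apply: m1 => //; first exact: measurable_rV_mulmx.
    by apply: measurable_rVD => //; exact: measurable_rV_mulmx.
  by move=> z; rewrite mule_ge0.
transitivity (\int[lebesgue_rV n]_y \int[lebesgue_rV n]_x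
    ((\1_A (x *m O - y))%:E * (\1_B (x *m O))%:E)).
  apply: eq_integral => y _.
  rewrite -[LHS](@ge0_integral_shift n (- (y *m O^T))%R).
  - apply: eq_integral => x _.
    by rewrite mulmxBl -mulmxA OtO mulmx1 [(y + _)%R]addrC subrK.
  - apply: emeasurable_funM; apply: m1' => //.
    by apply: measurable_rVD => //; exact: measurable_rV_mulmx.
  - by move=> x; rewrite mule_ge0.
transitivity (\int[lebesgue_rV n]_x \int[lebesgue_rV n]_y
    ((\1_A (x *m O - y))%:E * (\1_B (x *m O))%:E)).
  apply/esym; apply: (@fubini_tonelli _ _ _ _ R (lebesgue_rV n) (lebesgue_rV n)
    (fun z => (\1_A (z.1 *m O - z.2))%:E * (\1_B (z.1 *m O))%:E)).
    apply: emeasurable_funM; apply: m1 => //; last exact: measurable_rV_mulmx.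
    by apply: measurable_rVB => //; exact: measurable_rV_mulmx.
  by move=> z; rewrite mule_ge0.
transitivity (\int[lebesgue_rV n]_x (lebesgue_rV n A * (\1_B x)%:E)).
  apply: eq_integral => x _.
  rewrite ge0_integralZr//; last by apply: m1' => //; exact: measurable_rVB.
  congr (_ * _); last first.
    rewrite !indicE; congr (_%:R%:E); apply: congr1.
    by apply/idP/idP; rewrite !inE BO.
  rewrite [RHS]measure_integral_indic//.
  have N10 : (- 1 != 0 :> R)%R by rewrite oppr_eq0 oner_neq0.
  rewrite -[RHS](@ge0_integral_affine R n (-1)%R (x *m O) _ N10 (measurable_indicE mA))//.
  rewrite normrN1 expr1n mul1e; apply: eq_integral => y _.
  by rewrite scaleN1r addrC.
rewrite ge0_integralZl//; last exact: measurable_indicE.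
by rewrite -measure_integral_indic.
Qed.

Lemma ge0_integral_orthogonal n (O : 'M[R]_n) (f : 'rV[R]_n -> \bar R) :
  O *m O^T = 1%:M -> measurable_fun setT f -> (forall x, 0 <= f x) ->
  \int[lebesgue_rV n]_x f (x *m O) = \int[lebesgue_rV n]_x f x.
Proof.
move=> OO mf f0.
have mO : measurable_fun setT (fun x : 'rV[R]_n => x *m O).
  exact: measurable_rV_mulmx.
have := @ge0_integral_pushforward _ _ _ _ R _ mO (lebesgue_rV n) setT f
  measurableT mf (fun x _ => f0 x).
rewrite preimage_setT => <-.
by apply: eq_measure_integral => A mA _; exact: lebesgue_rV_orthogonal.
Qed.

End lebesgue_invariance.

(** * The isodiametric inequality *)

Section isodiametric.
Context {R : realType}.
Implicit Types n : nat.

Definition diam_le n (D : R) (A : set 'rV[R]_n) :=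
  forall x y, A x -> A y -> enorm (x - y) <= D.

(** Otherwise [A] lies in [[inf A, sup A]], whose length is at most [r]. The strict bound spares
    Steiner symmetrization the question whether the extremes of a section are attained. *)
Lemma exists_far_points (A : set R) (r : R) : measurable A ->
  (r%:E < lebesgue_measure A)%E -> 0 <= r ->
  exists a b, [/\ A a, A b & r < b - a].
Proof.
move=> mA rA r0; apply: contrapT => far.
have Ar a b : A a -> A b -> b - a <= r.
  by move=> Aa Ab; rewrite leNgt; apply/negP => rba; apply: far; exists a, b.
have [A0|/set0P[x Ax]] := eqVneq A set0.
  by move: rA; rewrite A0 measure0 lte_fin ltNge r0.
have subx : has_sup A.
  by split; [exists x|exists (x + r) => y Ay; have := Ar x y Ax Ay; rewrite lerBlDl].
have infx : has_inf A.
  by split; [exists x|exists (x - r) => y Ay; have := Ar y x Ay Ax; rewrite lerBlDl lerBlDr].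
have AI : A `<=` `[inf A, sup A]%classic.
  by move=> y Ay; rewrite /= in_itv/= ge_inf ?ub_le_sup//; [case: subx|case: infx].
have supinf : sup A - inf A <= r.
  rewrite lerBlDr -lerBlDl; apply: lb_le_inf; first by exists x.
  move=> y Ay; rewrite lerBlDr; apply: ge_sup; first by exists x.
  by move=> z Az; rewrite -lerBlDl; exact: Ar.
move: rA; rewrite ltNge => /negP; apply.
apply: (@le_trans _ _ (lebesgue_measure `[inf A, sup A]%classic)).
  by apply: le_measure; rewrite ?inE.
rewrite lebesgue_measure_itv/=; case: ifPn => _; last by rewrite lee_fin.
by rewrite -EFinB lee_fin.
Qed.

Definition section0 n (A : set 'rV[R]_n.+1) (w : 'rV[R]_n) : set R :=
  [set t | A (rV_cons (t, w))].

(** On each line parallel to the first axis, a centred open interval as long as the section of [A].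
    The strict inequality matches that of [exists_far_points]. *)
Definition steiner n (A : set 'rV[R]_n.+1) : set 'rV[R]_n.+1 :=
  [set v : 'rV[R]_n.+1 |
    ((2 * `|v ord0 ord0|)%:E < lebesgue_measure (section0 A (rV_uncons v).2))%E].

Lemma steiner_cons n (A : set 'rV[R]_n.+1) t w : steiner A (rV_cons (t, w)) =
  ((2 * `|t|)%:E < lebesgue_measure (section0 A w))%E :> Prop.
Proof. by rewrite /steiner /mkset rV_cons_coord0 rV_consK. Qed.

Lemma measurable_section0 n (A : set 'rV[R]_n.+1) w :
  measurable A -> measurable (section0 A w).
Proof.
move=> mA; apply: (@measurable_preimage _ _ _ _
  (fun t : measurableTypeR R => rV_cons (t, w))) => //.
exact: measurable_rV_consf.
Qed.

Lemma measurable_lebesgue_section0 n (A : set 'rV[R]_n.+1) : measurable A ->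
  measurable_fun setT (fun w => lebesgue_measure (section0 A w)).
Proof.
move=> mA.
have mA' : measurable (@rV_cons R n @^-1` A).
  by apply: measurable_preimage => //; exact: measurable_rV_cons.
have := @measurable_fun_ysection _ _ _ _ R lebesgue_measure _ mA'.
congr (measurable_fun _ _); apply/funext => w /=; congr (lebesgue_measure _).
by apply/seteqP; split => t; rewrite /section0 /ysection/= inE.
Qed.

Lemma measurable_steiner n (A : set 'rV[R]_n.+1) : measurable A ->
  measurable (steiner A).
Proof.
move=> mA.
pose f (v : 'rV[R]_n.+1) := ((2 * `|v ord0 ord0|)%:E <
  lebesgue_measure (section0 A (rV_uncons v).2))%E.
rewrite (_ : steiner A = f @^-1` [set true]).
  apply: measurable_preimage => //; apply: measurable_fun_lte.
    apply/measurable_EFinP; apply: measurable_funM => //.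
    by apply: measurableT_comp => //; exact: (measurable_rV_coord (ord0 : 'I_n.+1)).
  apply: (measurableT_comp (measurable_lebesgue_section0 mA)).
  by apply: measurableT_comp => //; exact: measurable_rV_uncons.
by apply/seteqP; split => v.
Qed.

Lemma lebesgue_norm_lt (L : \bar R) : (0 <= L)%E ->
  lebesgue_measure [set t : R | ((2 * `|t|)%:E < L)%E] = L.
Proof.
case: L => [r r0||//].
  rewrite (_ : mkset _ = `](- (r / 2)), (r / 2)[%classic).
    rewrite lebesgue_measure_itv/= lte_fin -EFinB; case: ltP => r2; congr EFin.
      by field.
    by move: r0 r2; rewrite lee_fin => *; lra.
  have E t : (2 * `|t| < r) = (- (r / 2) < t < r / 2).
    by rewrite -ltr_norml ltr_pdivlMr// mulrC.
  by apply/seteqP; split => t; rewrite /= in_itv/= lte_fin E.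
move=> _; rewrite (_ : mkset _ = setT).
  by rewrite -(@set_itvNyy _ R) lebesgue_measure_itv.
by apply/seteqP; split => t //= _; exact: ltry.
Qed.

Lemma lebesgue_steiner n (A : set 'rV[R]_n.+1) : measurable A ->
  lebesgue_rV n.+1 (steiner A) = lebesgue_rV n.+1 A.
Proof.
move=> mA.
have E (B : set 'rV[R]_n.+1) : measurable B -> lebesgue_rV n.+1 B =
    (\int[lebesgue_rV n]_w lebesgue_measure (section0 B w))%E.
  move=> mB; rewrite measure_integral_indic// lebesgue_rV_fubini2//.
    apply: eq_integral => w _.
    by rewrite [RHS]measure_integral_indic//; exact: measurable_section0.
  exact: measurable_indicE.
rewrite !E//; last exact: measurable_steiner.
apply: eq_integral => w _.
rewrite -[RHS](lebesgue_norm_lt (measure_ge0 _ _)); congr (lebesgue_measure _).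
by apply/seteqP; split => t; rewrite -[section0 (steiner A) w t]/(steiner A _) steiner_cons.
Qed.

Lemma enorm_consB n s t (u v : 'rV[R]_n) :
  enorm (rV_cons (s, u) - rV_cons (t, v)) = Num.sqrt ((s - t) ^+ 2 + enorm (u - v) ^+ 2).
Proof. by rewrite rV_consB enorm_cons. Qed.

(** The section over [u] contains [a], [b] with [b - a > 2 |s|], the one over [v] contains [c], [d]
    with [d - c > 2 |t|]. As [(b - c) + (d - a) > 2 (|s| + |t|)], one of the two differences is at
    least [|s| + |t| >= |s - t|], and the corresponding pair of points of [A] is at least as far
    apart as the given pair. *)
Lemma diam_le_steiner n (D : R) (A : set 'rV[R]_n.+1) : measurable A ->
  diam_le D A -> diam_le D (steiner A).
Proof.
move=> mA AD x y; have [s [u ->]] := rV_consP x; have [t [v ->]] := rV_consP y.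
rewrite !steiner_cons => hs ht.
have [a [b [Aa Ab ab]]] :=
  exists_far_points (measurable_section0 u mA) hs (mulr_ge0 (ler0n _ 2) (normr_ge0 s)).
have [c [d [Ac Ad cd]]] :=
  exists_far_points (measurable_section0 v mA) ht (mulr_ge0 (ler0n _ 2) (normr_ge0 t)).
have st : `|s - t| <= `|s| + `|t| by exact: ler_normB.
rewrite enorm_consB.
have key p q : A (rV_cons (p, u)) -> A (rV_cons (q, v)) -> `|s - t| <= `|p - q| ->
    Num.sqrt ((s - t) ^+ 2 + enorm (u - v) ^+ 2) <= D.
  move=> Ap Aq pq; rewrite (le_trans _ (AD _ _ Ap Aq))// enorm_consB.
  rewrite ler_sqrt ?addr_ge0 ?sqr_ge0// lerD2r.
  by rewrite -real_normK ?num_real// -[leRHS]real_normK ?num_real// lerXn2r ?nnegrE.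
have [h|h] := leP (`|s| + `|t|) (b - c).
  by apply: (key b c) => //; rewrite (le_trans st)// (le_trans h)// ler_norm.
apply: (key a d) => //; rewrite (le_trans st)// distrC (le_trans _ (ler_norm _))//; lra.
Qed.

Definition flip n (i : 'I_n) (x : 'rV[R]_n) : 'rV[R]_n :=
  \row_j (if j == i then - x ord0 j else x ord0 j).

Definition flip_sym n (i : 'I_n) (A : set 'rV[R]_n) := forall x, A (flip i x) <-> A x.

Lemma steiner_flip0 n (A : set 'rV[R]_n.+1) : flip_sym ord0 (steiner A).
Proof.
move=> x; have [t [w ->]] := rV_consP x.
have -> : flip ord0 (rV_cons (t, w)) = rV_cons (- t, w).
  apply: eq_rV_cons => [|i]; rewrite mxE/=.
    by rewrite !rV_cons_coord0.
  by rewrite !rV_cons_lift.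
by rewrite !steiner_cons normrN.
Qed.

Lemma steiner_flip_lift n (A : set 'rV[R]_n.+1) (i : 'I_n) :
  flip_sym (lift ord0 i) A -> flip_sym (lift ord0 i) (steiner A).
Proof.
move=> symA.
have E t w : flip (lift ord0 i) (rV_cons (t, w)) = rV_cons (t, flip i w).
  apply: eq_rV_cons => [|j]; rewrite mxE/= ?rV_cons_coord0// !rV_cons_lift mxE.
  by rewrite (inj_eq lift_inj).
move=> x; have [t [w ->]] := rV_consP x.
rewrite E !steiner_cons.
suff -> : section0 A (flip i w) = section0 A w by [].
by apply/seteqP; split => s; rewrite /section0/= -E symA.
Qed.

Definition swap n (j : 'I_n.+1) : 'M[R]_n.+1 := perm_mx (tperm ord0 j).

Lemma swapE n (j : 'I_n.+1) (x : 'rV[R]_n.+1) i :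
  (x *m swap j) ord0 i = x ord0 (tperm ord0 j i).
Proof. by rewrite /swap -tpermV -col_permE mxE tpermV. Qed.

Lemma swap_orthogonal n (j : 'I_n.+1) : swap j *m (swap j)^T = 1%:M.
Proof. by rewrite tr_perm_mx -perm_mxM mulgV perm_mx1. Qed.

Lemma enorm_orthogonal n (O : 'M[R]_n) (x : 'rV[R]_n) : O *m O^T = 1%:M ->
  enorm (x *m O) = enorm x.
Proof. by move=> OO; rewrite /enorm !dotpE trmx_mul -mulmxA (mulmxA O) OO mul1mx. Qed.

Definition steiner_at n (j : 'I_n.+1) (A : set 'rV[R]_n.+1) : set 'rV[R]_n.+1 :=
  [set x | steiner [set y | A (y *m swap j)] (x *m swap j)].

Lemma flip_swap n (i j : 'I_n.+1) (x : 'rV[R]_n.+1) :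
  flip i x *m swap j = flip (tperm ord0 j i) (x *m swap j).
Proof.
apply/rowP => k; rewrite [RHS]mxE !swapE mxE.
by rewrite -(inj_eq (@perm_inj _ (tperm ord0 j)) k) tpermK.
Qed.

(** Symmetrizing along [j] keeps the earlier symmetries: conjugation by the transposition of 0 and
    [j] turns the flip of [i] into the flip of a coordinate other than 0 when [i] differs from [j],
    and [steiner_flip_lift] applies. *)
Lemma steiner_atP n (j : 'I_n.+1) (D : R) (A : set 'rV[R]_n.+1) :
  measurable A -> diam_le D A ->
  [/\ measurable (steiner_at j A), diam_le D (steiner_at j A),
      lebesgue_rV n.+1 (steiner_at j A) = lebesgue_rV n.+1 A,
      flip_sym j (steiner_at j A) &
      forall i, flip_sym i A -> flip_sym i (steiner_at j A)].
Proof.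
move=> mA AD.
have mS : measurable_fun setT (fun x : 'rV[R]_n.+1 => x *m swap j).
  exact: measurable_rV_mulmx.
have mB : measurable [set y | A (y *m swap j)] by exact: measurable_preimage.
have BD : diam_le D [set y | A (y *m swap j)].
  move=> x y Ax Ay; have := AD _ _ Ax Ay.
  by rewrite -mulmxBl enorm_orthogonal// swap_orthogonal.
have symj : flip_sym j (steiner_at j A).
  by move=> x; rewrite /steiner_at/= flip_swap tpermR; exact: steiner_flip0.
split => //.
- by apply: measurable_preimage => //; exact: measurable_steiner.
- move=> x y Ax Ay; have := diam_le_steiner mB BD Ax Ay.
  by rewrite -mulmxBl enorm_orthogonal// swap_orthogonal.
- rewrite lebesgue_rV_orthogonal//; [|exact: swap_orthogonal|exact: measurable_steiner].
  by rewrite lebesgue_steiner// lebesgue_rV_orthogonal//; exact: swap_orthogonal.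
- move=> i symi; have [->//|ij] := eqVneq i j.
  move=> x; rewrite /steiner_at/= flip_swap.
  case: (unliftP ord0 (tperm ord0 j i)) => [k|] iE.
    rewrite iE; apply: steiner_flip_lift => y /=.
    by rewrite -iE flip_swap tpermK; exact: symi.
  by move/(congr1 (tperm ord0 j)) : iE; rewrite tpermK tpermL => /eqP; rewrite (negbTE ij).
Qed.

(** Symmetrize along every coordinate in turn; the composite of all flips is [x] to [- x]. *)
Lemma full_symmetrization n (D : R) (A : set 'rV[R]_n.+1) :
  measurable A -> diam_le D A ->
  exists B, [/\ measurable B, diam_le D B, lebesgue_rV n.+1 B = lebesgue_rV n.+1 A &
    forall x, B x -> B (- x)].
Proof.
move=> mA AD.
suff [B [mB BD BA symB]] : exists B, [/\ measurable B, diam_le D B,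
    lebesgue_rV n.+1 B = lebesgue_rV n.+1 A & forall i, i \in enum 'I_n.+1 -> flip_sym i B].
  exists B; split => // x Bx.
  have H (s : seq 'I_n.+1) : uniq s ->
      B (\row_i (if i \in s then - x ord0 i else x ord0 i)).
    elim: s => [_|j s IH /= /andP[js us]].
      by rewrite (_ : \row_i _ = x)//; apply/rowP => i; rewrite mxE.
    have := IH us; rewrite -(symB j) ?mem_enum//.
    congr B; apply/rowP => i; rewrite !mxE inE.
    by have [->|ij] := eqVneq i j; rewrite ?(negbTE js).
  have := H _ (enum_uniq 'I_n.+1); congr B.
  by apply/rowP => i; rewrite !mxE mem_enum.
elim: (enum 'I_n.+1) => [|j s [B [mB BD BA symB]]]; first by exists A.
have [m' D' A' sj si] := steiner_atP j mB BD.
exists (steiner_at j B); split => //; first by rewrite A'.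
move=> i; rewrite inE => /orP[/eqP->//|/symB]; exact: si.
Qed.

(** For the symmetrized set [B], both [x] and [- x] belong to [B], so [2 |x| <= D]: the set lies in
    a closed ball of radius [D / 2]. *)
Lemma isodiametric n (D : R) (A : set 'rV[R]_n.+1) :
  0 <= D -> measurable A -> diam_le D A ->
  (lebesgue_rV n.+1 A <= (unit_ball_volume n.+1 * (D / 2) ^+ n.+1)%:E)%E.
Proof.
move=> D0 mA AD; have [B [mB BD <- symB]] := full_symmetrization mA AD.
(* [horizon] is an open ball, hence a radius [r > D / 2], which then decreases to [D / 2]. This also
   covers [D = 0]. *)
have Br r : D / 2 < r -> (lebesgue_rV n.+1 B <= (unit_ball_volume n.+1 * r ^+ n.+1)%:E)%E.
  move=> Dr; have r0 : 0 < r by rewrite (le_lt_trans _ Dr)// divr_ge0.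
  rewrite -(lebesgue_horizon 0 r0); apply: le_measure; rewrite ?inE//.
    exact: measurable_horizon.
  move=> x Bx; rewrite /horizon/= subr0 (le_lt_trans _ Dr)//.
  rewrite ler_pdivlMr//; have := BD _ _ Bx (symB _ Bx).
  by rewrite opprK -mulr2n -scaler_nat enormZ ger0_norm// mulrC.
rewrite leNgt; apply/negP => lt.
have c : (fun r : R => (unit_ball_volume n.+1 * r ^+ n.+1)) r @[r --> D / 2] -->
    unit_ball_volume n.+1 * (D / 2) ^+ n.+1.
  by apply: cvgM; [exact: cvg_cst|exact: exprn_continuous].
have finB : lebesgue_rV n.+1 B \is a fin_num.
  by rewrite ge0_fin_numE// (le_lt_trans (Br (D / 2 + 1) _)) ?ltry// ltrDl.
move: lt; rewrite -(fineK finB) lte_fin => lt.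
have : \forall r \near (D / 2)^'+,
    unit_ball_volume n.+1 * r ^+ n.+1 < fine (lebesgue_rV n.+1 B).
  exact: (cvgr_lt _ (cvg_at_right_filter c)).
move=> /(filterI (nbhs_right_gt (D / 2))) /filter_ex[r [/= Dr]].
by apply/negP; rewrite -leNgt -lee_fin fineK//; exact: Br.
Qed.

End isodiametric.

(** * Hausdorff measure and Lebesgue measure *)

Section grid.
Context {R : realType}.
Implicit Types n : nat.

Definition cell n (s : R) (k : 'rV[int]_n) : set 'rV[R]_n :=
  box (\row_i (s * (k ord0 i)%:~R)) (\row_i (s * ((k ord0 i)%:~R + 1))).

(** Enumeration by natural numbers, for countable sums. [pickle_inv] succeeds only on exact codes,
    so each cube is listed once and the family is disjoint. *)
Definition cells n (s : R) (m : nat) : set 'rV[R]_n :=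
  if pickle_inv m is Some k then cell s (k : 'rV[int]_n) else set0.

Lemma measurable_cell n s (k : 'rV[int]_n) : measurable (cell s k).
Proof. exact: measurable_box. Qed.

Lemma measurable_cells n s m : measurable (@cells n s m).
Proof. by rewrite /cells; case: pickle_inv => // k; exact: measurable_cell. Qed.

Lemma lebesgue_cell n s (k : 'rV[int]_n) : 0 <= s ->
  lebesgue_rV n (cell s k) = (s ^+ n)%:E.
Proof.
move=> s0; rewrite lebesgue_rV_box => [|i]; last by rewrite !mxE ler_wpM2l// lerDl.
congr EFin; rewrite -[in RHS](card_ord n) -prodr_const.
by apply: eq_bigr => i _; rewrite !mxE; ring.
Qed.

Lemma cells_cover n s (x : 'rV[R]_n) : 0 < s -> exists m, @cells n s m x.
Proof.
move=> s0; exists (pickle (\row_i Num.floor (x ord0 i / s) : 'rV[int]_n)).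
rewrite /cells pickleK_inv => i; rewrite !mxE.
have := floor_le (x ord0 i / s); have := lt_succ_floor (x ord0 i / s).
rewrite ltr_pdivrMr// ler_pdivlMr// intrD mulrC => -> .
by rewrite mulrC => ->.
Qed.

Lemma cell_inj n s (k l : 'rV[int]_n) x : 0 < s -> cell s k x -> cell s l x -> k = l.
Proof.
move=> s0 kx lx; apply/rowP => i.
have := kx i; have := lx i; rewrite !mxE => /andP[l1 l2] /andP[k1 k2].
have := le_lt_trans l1 k2; have := le_lt_trans k1 l2.
rewrite !ltr_pM2l// -!(intrD _ _ 1) !ltr_int !ltzD1 => kl lk.
by apply/eqP; rewrite eq_le kl lk.
Qed.

Lemma trivIset_cells n s : 0 < s -> trivIset setT (@cells n s).
Proof.
move=> s0 i j _ _ [x [ix jx]]; move: ix jx; rewrite /cells.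
case Ei : (pickle_inv i) => [k|]//; case Ej : (pickle_inv j) => [l|]// kx lx.
have := @pickle_invK 'rV[int]_n i; have := @pickle_invK 'rV[int]_n j.
by rewrite Ei Ej /= (cell_inj s0 kx lx) => -> .
Qed.

Lemma cell_diam n s (k : 'rV[int]_n) x y : 0 <= s ->
  cell s k x -> cell s k y -> enorm (x - y) <= s *+ n.
Proof.
move=> s0 kx ky; apply: enorm_le_bound => i.
have := kx i; have := ky i; rewrite !mxE mulrDr mulr1 => /andP[l1 l2] /andP[k1 k2].
by rewrite ler_norml; apply/andP; split; lra.
Qed.

Lemma cells_diam n s m x y : 0 <= s ->
  @cells n s m x -> @cells n s m y -> enorm (x - y) <= s *+ n.
Proof. by rewrite /cells; case: pickle_inv => // k; exact: cell_diam. Qed.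

(** Whole cubes rather than their traces on [U], so the union is Borel for arbitrary [U]. *)
Definition cells_meeting n s (U : set 'rV[R]_n) m : set 'rV[R]_n :=
  if `[< @cells n s m `&` U !=set0 >] then @cells n s m else set0.

Lemma measurable_cells_meeting n s (U : set 'rV[R]_n) m :
  measurable (cells_meeting s U m).
Proof. by rewrite /cells_meeting; case: ifP => // _; exact: measurable_cells. Qed.

Lemma cells_meeting_sub n s (U : set 'rV[R]_n) m :
  cells_meeting s U m `<=` @cells n s m.
Proof. by rewrite /cells_meeting; case: ifP => _; [exact: subset_refl|exact: sub0set]. Qed.

Lemma trivIset_cells_meeting n s (U : set 'rV[R]_n) : 0 < s ->
  trivIset setT (cells_meeting s U).
Proof.
move=> s0 i j _ _ [x [ix jx]]; apply: (trivIset_cells s0) => //.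
by exists x; split; apply: cells_meeting_sub; [exact: ix|exact: jx].
Qed.

Lemma cells_meeting_cover n s (U : set 'rV[R]_n) : 0 < s ->
  U `<=` \bigcup_m cells_meeting s U m.
Proof.
move=> s0 x Ux; have [m mx] := cells_cover x s0; exists m => //.
by rewrite /cells_meeting; case: asboolP => // -[]; exists x.
Qed.

Lemma cells_meetingP n s (U : set 'rV[R]_n) m x : 0 <= s -> cells_meeting s U m x ->
  exists2 u, U u & enorm (x - u) <= s *+ n.
Proof.
rewrite /cells_meeting => s0; case: asboolP => // -[u [mu Uu]] mx.
by exists u => //; exact: cells_diam mx mu.
Qed.

(* A Borel set between U and its closure, hence of the same diameter as U. *)
Definition fuzz n (U : set 'rV[R]_n) : set 'rV[R]_n :=
  \bigcap_j \bigcup_m cells_meeting j.+1%:R^-1 U m.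

Lemma measurable_fuzz n (U : set 'rV[R]_n) : measurable (fuzz U).
Proof.
apply: bigcapT_measurable => j; apply: bigcupT_measurable => m.
exact: measurable_cells_meeting.
Qed.

Lemma sub_fuzz n (U : set 'rV[R]_n) : U `<=` fuzz U.
Proof. by move=> x Ux j _; apply: cells_meeting_cover. Qed.

Lemma diam_le_fuzz n (D : R) (U : set 'rV[R]_n) : diam_le D U -> diam_le D (fuzz U).
Proof.
move=> UD x y Ux Uy; apply/ler_addgt0Pr => e e0.
(* Cubes of side [1/(j+1)] have diameter at most [n/(j+1)]; this [j] makes twice that, once for [x]
   and once for [y], at most [e]. *)
pose j := Num.truncn (e^-1 * (2 * n)%:R).
have je : j.+1%:R^-1 *+ n *+ 2 <= e.
  rewrite -mulrnA mulnC -[leLHS]mulr_natl ler_pdivrMr//.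
  by rewrite mulrC -ler_pdivrMr// mulrC ltW// truncnS_gt.
have [mx _ /cells_meetingP[//|u Uu xu]] := Ux j I.
have [my _ /cells_meetingP[//|v Uv yv]] := Uy j I.
have := enormB_trans u x y; have := enormB_trans v u y; have := UD u v Uu Uv.
rewrite (enormBC v y); move: xu yv je; rewrite mulr2n.
move: (_ *+ n) => c; lra.
Qed.

End grid.

Section ediam_facts.
Context {R : realType} {n : nat}.
Implicit Types U : set 'rV[R]_n.

Lemma ediam_ge0 U : (0 <= ediam U)%E.
Proof. by rewrite /ediam le_max lexx. Qed.

Lemma ediam_leP U (D : R) : 0 <= D -> (ediam U <= D%:E)%E <-> diam_le D U.
Proof.
move=> D0; rewrite /ediam ge_max lee_fin D0 /=; split=> [UD x y Ux Uy|UD].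
  rewrite -lee_fin (le_trans _ UD)//; apply: ereal_sup_ubound => /=.
  by exists (x, y).
by apply: ge_ereal_sup => _ [[x y] [Ux Uy] <-]; rewrite lee_fin UD.
Qed.

Lemma ediam0 : ediam (@set0 'rV[R]_n) = 0%E.
Proof.
by apply/eqP; rewrite eq_le ediam_ge0 andbT; apply/(ediam_leP _ (lexx 0)).
Qed.

End ediam_facts.

(** * Outer measures generated by weighted coverings *)

Section cover_outer.
Context {R : realType} {n : nat}.
Local Open Scope ereal_scope.
Implicit Types (w : set 'rV[R]_n -> \bar R) (A S U X : set 'rV[R]_n).

Let T := g_sigma_algebraType [set: set 'rV[R]_n].

(* Every set is measurable for this sigma-algebra, so that mu_ext ranges over
   all coverings; inadmissible covering sets get weight +oo. *)
Definition cover_outer w : set 'rV[R]_n -> \bar R :=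
  @mu_ext _ T R w.

Lemma cover_outer_le w A (U : nat -> set 'rV[R]_n) :
  A `<=` \bigcup_i U i -> cover_outer w A <= \sum_(i <oo) w (U i).
Proof.
move=> AU; apply: ereal_inf_lbound; exists U => //; split => // i.
exact: sub_sigma_algebra.
Qed.

Lemma cover_outer_ge w A (l : \bar R) :
  (forall U : nat -> set 'rV[R]_n, A `<=` \bigcup_i U i -> l <= \sum_(i <oo) w (U i)) ->
  l <= cover_outer w A.
Proof. by move=> h; apply: le_ereal_inf_tmp => _ [U [_ AU] <-]; exact: h. Qed.

Lemma cover_outer_mono w A B : A `<=` B -> cover_outer w A <= cover_outer w B.
Proof. by move=> AB; exact: (@le_mu_ext _ T R w). Qed.

Variable w : set 'rV[R]_n -> \bar R.
Hypothesis w_ge0 : forall U, 0 <= w U.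
Hypothesis w0 : w set0 = 0.

Lemma cover_outer0 : cover_outer w set0 = 0.
Proof. exact: (@mu_ext0 _ T R w). Qed.

Lemma cover_outer_ge0 A : 0 <= cover_outer w A.
Proof. exact: (@mu_ext_ge0 _ T R w). Qed.

Lemma cover_outer_sigma_subadditive : sigma_subadditive (cover_outer w).
Proof. exact: (@mu_ext_sigma_subadditive _ T R w). Qed.

Lemma cover_outer_weight A : cover_outer w A <= w A.
Proof.
apply: (@le_trans _ _ (\sum_(i <oo) w (if i is 0%N then A else set0))).
  by apply: cover_outer_le => x Ax; exists 0%N.
rewrite nneseries_recl// eseries_cond/= eseries0 ?adde0// => -[|]//= k _ _.
Qed.

Lemma cover_outerU A B : cover_outer w (A `|` B) <= cover_outer w A + cover_outer w B.
Proof.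
pose mix := isOuterMeasure.Build R _ (cover_outer w) cover_outer0 cover_outer_ge0
  (fun A B => @cover_outer_mono w A B) cover_outer_sigma_subadditive.
pose nu : {outer_measure set _ -> \bar R} := HB.pack (cover_outer w) mix.
exact: (outer_measureU2 nu).
Qed.

(** Since the weight splits along every half-space [x_i < c], these half-spaces satisfy the
    Caratheodory condition. They generate the Borel sets. *)
Lemma cover_outer_split A :
  (forall i c U, w (U `&` [set x | x ord0 i < c]%R) +
                 w (U `&` ~` [set x | x ord0 i < c]%R) <= w U) ->
  measurable A -> forall X,
  cover_outer w X = cover_outer w (X `&` A) + cover_outer w (X `&` ~` A).
Proof.
move=> wS mA.
pose mix := isOuterMeasure.Build R _ (cover_outer w) cover_outer0 cover_outer_ge0
  (fun A B => @cover_outer_mono w A B) cover_outer_sigma_subadditive.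
pose nu : {outer_measure set _ -> \bar R} := HB.pack (cover_outer w) mix.
(* Measurability of the identity, from the Caratheodory sigma-algebra to the Borel one, says that
   Borel sets are Caratheodory measurable. It can be tested on coordinates and rays. *)
suff mid : measurable_fun [set: caratheodory_type nu]
    (id : caratheodory_type nu -> 'rV[R]_n).
  have := mid measurableT A mA; rewrite setTI preimage_id.
  by [].
apply: measurable_fun_rV => i.
apply: (measurability _ (RGenInftyO.measurableE R)) => _ [_ [c -> <-]].
rewrite setTI (_ : _ @^-1` _ = [set x : 'rV[R]_n | x ord0 i < c]%R); last first.
  by apply/seteqP; split => x; rewrite /= in_itv.
apply: (le_caratheodory_measurable (mu := nu)) => X.
apply: cover_outer_ge => U XU.
apply: (@le_trans _ _ (\sum_(j <oo) (w (U j `&` [set x | x ord0 i < c]%R) +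
    w (U j `&` ~` [set x | x ord0 i < c]%R)))); last first.
  by apply: lee_nneseries => // j _; rewrite adde_ge0.
rewrite nneseriesD//; apply: leeD; apply: cover_outer_le; rewrite -setI_bigcupl; exact: setSI.
Qed.

End cover_outer.

(** * Lebesgue measure as the outer measure of coverings by boxes *)

Section box_outer.
Context {R : realType} {n : nat}.
Local Open Scope ereal_scope.
Implicit Types A U : set 'rV[R]_n.+1.

Definition box_weight U : \bar R :=
  if `[< exists a b, U = box a b >] then lebesgue_rV n.+1 U else +oo.

Lemma box_weight_ge0 U : 0 <= box_weight U.
Proof. by rewrite /box_weight; case: ifP. Qed.

Lemma box_empty (a b : 'rV[R]_n.+1) i : (b ord0 i <= a ord0 i)%R -> box a b = set0.
Proof.
move=> ba; apply/seteqP; split => // x /(_ i) /andP[ax xb].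
by move: (le_lt_trans ax xb); rewrite ltNge ba.
Qed.

Lemma box_weight_box (a b : 'rV[R]_n.+1) :
  box_weight (box a b) = lebesgue_rV n.+1 (box a b).
Proof. by rewrite /box_weight; case: asboolP => // -[]; exists a, b. Qed.

Lemma box_weight0 : box_weight set0 = 0.
Proof.
by rewrite -(@box_empty 0 0 ord0)// box_weight_box (@box_empty _ _ ord0)// measure0.
Qed.

Lemma box_lt (a b : 'rV[R]_n.+1) i c : box a b `&` [set x | x ord0 i < c]%R =
  box a (\row_j if j == i then Num.min (b ord0 j) c else b ord0 j).
Proof.
apply/seteqP; split => x /= => [[xab xc] j|xab].
  rewrite mxE; case: eqP => [->|_]; last exact: xab.
  by rewrite lt_min xc andbT; exact: xab.
split=> [j|]; last by have := xab i; rewrite mxE eqxx lt_min => /and3P[].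
by have := xab j; rewrite mxE; case: eqP => // _; rewrite lt_min => /and3P[-> ->].
Qed.

Lemma box_ge (a b : 'rV[R]_n.+1) i c : box a b `&` ~` [set x | x ord0 i < c]%R =
  box (\row_j if j == i then Num.max (a ord0 j) c else a ord0 j) b.
Proof.
apply/seteqP; split => x /= => [[xab /negP]|xab].
  rewrite -leNgt => xc j; rewrite mxE; case: eqP => [->|_]; last exact: xab.
  by rewrite ge_max xc andbT; exact: xab.
split=> [j|]; last first.
  have := xab i; rewrite mxE eqxx ge_max => /andP[/andP[_ ci] _].
  by apply/negP; rewrite -leNgt.
by have := xab j; rewrite mxE; case: eqP => // _; rewrite ge_max => /andP[/andP[-> _] ->].
Qed.

Lemma box_weight_split i c U :
  box_weight (U `&` [set x | x ord0 i < c]%R) +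
  box_weight (U `&` ~` [set x | x ord0 i < c]%R) <= box_weight U.
Proof.
have [[a [b ->]]|UN] := pselect (exists a b, U = box a b); last first.
  by rewrite [leRHS]/box_weight; case: asboolP => // _; rewrite leey.
rewrite box_lt box_ge !box_weight_box -box_lt -box_ge -measureU//.
- by rewrite -setIUr setUv setIT.
- by rewrite box_lt; exact: measurable_box.
- by rewrite box_ge; exact: measurable_box.
- by rewrite setIACA setICr setI0.
Qed.

Lemma lebesgue_le_box_outer A : measurable A ->
  lebesgue_rV n.+1 A <= cover_outer box_weight A.
Proof.
move=> mA; apply: cover_outer_ge => U AU.
have [Ub|/existsNP[j Uj]] := pselect (forall j, exists a b, U j = box a b); last first.
  rewrite [leRHS](_ : _ = +oo) ?leey//; apply: (@nneseries_pinfty _ _ _ j) => // [i _|].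
    exact: box_weight_ge0.
  by rewrite /box_weight; case: asboolP.
have mU j : measurable (U j) by have [a [b ->]] := Ub j; exact: measurable_box.
apply: (le_trans (measure_sigma_subadditive (lebesgue_rV n.+1) mU mA AU)).
apply: lee_nneseries => // j _.
by have [a [b ->]] := Ub j; rewrite box_weight_box.
Qed.

(** This outer regularity by boxes carries estimates from boxes to Borel sets. It is proved in each
    unit cube and summed over the cubes. *)
Lemma box_outer_le_lebesgue A : measurable A ->
  cover_outer box_weight A <= lebesgue_rV n.+1 A.
Proof.
move=> mA.
have split B := @cover_outer_split _ _ _ box_weight_ge0 box_weight0 B box_weight_split.
have cellA m : cover_outer box_weight (A `&` @cells R n.+1 1 m) <=
    lebesgue_rV n.+1 (A `&` @cells R n.+1 1 m).
  rewrite /cells; case: pickle_inv => [k|]; last first.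
    by rewrite setI0 cover_outer0 ?box_weight0//; exact: box_weight_ge0.
  have mK := measurable_cell (1 : R)%R k.
  have finK : lebesgue_rV n.+1 (cell (1 : R)%R k) < +oo.
    by rewrite lebesgue_cell ?ltry.
  have mKA : measurable (cell (1 : R)%R k `&` ~` A).
    by apply: measurableI => //; exact: measurableC.
  have finKA : lebesgue_rV n.+1 (cell (1 : R)%R k `&` ~` A) \is a fin_num.
    rewrite ge0_fin_numE//; apply: le_lt_trans finK.
    by apply: le_measure; rewrite ?inE//; exact: mKA.
  (* Complementation in the cube [K]: the outer measures of [K] inside and outside [A] add up to at
     most [|K|], and the part outside is at least the finite [|K \ A|], which is subtracted. *)
  rewrite setIC -(leeD2rE _ _ finKA).
  apply: (@le_trans _ _ (cover_outer box_weight (cell (1 : R)%R k))).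
    rewrite [leRHS](split A)//; apply: leeD => //; exact: lebesgue_le_box_outer.
  apply: (@le_trans _ _ (lebesgue_rV n.+1 (cell (1 : R)%R k))).
    by rewrite /cell -box_weight_box; apply: cover_outer_weight => //;
      [exact: box_weight_ge0|exact: box_weight0].
  rewrite -measureU//; first by rewrite -setIUr setUv setIT.
    exact: measurableI.
  by rewrite setIACA setICr setI0.
have AE : A = \bigcup_m (A `&` @cells R n.+1 1 m).
  rewrite -setI_bigcupr; apply/esym/setIidPl => x _.
  by have [m] := cells_cover x ltr01; exists m.
rewrite {1}AE.
apply: le_trans (cover_outer_sigma_subadditive box_weight_ge0 _) _.
apply: (@le_trans _ _ (\sum_(m <oo) lebesgue_rV n.+1 (A `&` @cells R n.+1 1 m))).
  apply: lee_nneseries => [m _ _|m _]; last exact: cellA.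
  by apply: cover_outer_ge0; exact: box_weight_ge0.
rewrite -measure_semi_bigcup -?AE//.
- by move=> m; apply: measurableI => //; exact: measurable_cells.
- apply/trivIsetP => i j _ _ ij; rewrite setIACA.
  by have /trivIsetP -> := @trivIset_cells R n.+1 _ ltr01; rewrite ?setI0.
Qed.

End box_outer.

Section hausdorff_weight.
Context {R : realType} {n : nat}.
Local Open Scope ereal_scope.
Implicit Types (U S : set 'rV[R]_n).

Definition hausdorff_weight k (delta : R) U : \bar R :=
  if ediam U <= delta%:E then (unit_ball_volume k / 2 ^+ k)%:E * ediam U ^+ k
  else +oo.

Lemma ball_ratio_gt0 k : (0 < unit_ball_volume k / 2 ^+ k :> R)%R.
Proof. by rewrite divr_gt0 ?unit_ball_volume_gt0 ?exprn_gt0. Qed.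

Lemma hausdorff_weight_ge0 k delta U : 0 <= hausdorff_weight k delta U.
Proof.
rewrite /hausdorff_weight; case: ifP => // _.
by rewrite mule_ge0 ?lee_fin ?(ltW (ball_ratio_gt0 _))// expe_ge0// ediam_ge0.
Qed.

(** A positive exponent is essential: with exponent 0 the empty set would have weight
    [unit_ball_volume 0 > 0]. *)
Lemma hausdorff_weight0 k delta : (0 <= delta)%R ->
  hausdorff_weight k.+1 delta set0 = 0.
Proof. by move=> d0; rewrite /hausdorff_weight ediam0 lee_fin d0 expeS mul0e mule0. Qed.

Lemma hausdorff_weight_le k delta U (D : R) : (0 <= D <= delta)%R -> diam_le D U ->
  hausdorff_weight k delta U <= (unit_ball_volume k / 2 ^+ k * D ^+ k)%:E.
Proof.
move=> /andP[D0 Dd] /(ediam_leP _ D0) UD.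
rewrite /hausdorff_weight (le_trans UD) ?lee_fin// EFinM.
have := ediam_ge0 U; move: UD; case: (ediam U) => [r||]//.
rewrite !lee_fin => rD r0; rewrite -EFin_expe -EFinM lee_fin.
by rewrite ler_wpM2l ?(ltW (ball_ratio_gt0 _))// lerXn2r.
Qed.

Lemma hausdorff_preE k delta S :
  hausdorff_pre k delta S = cover_outer (hausdorff_weight k delta) S.
Proof.
apply/eqP; rewrite eq_le; apply/andP; split.
  apply: cover_outer_ge => U SU.
  have [Ud|/existsNP[j Uj]] := pselect (forall j, ediam (U j) <= delta%:E); last first.
    rewrite [leRHS](_ : _ = +oo) ?leey//; apply: (@nneseries_pinfty _ _ _ j) => // [i _|].
      exact: hausdorff_weight_ge0.
    by rewrite /hausdorff_weight; case: ifP.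
  apply: ereal_inf_lbound; exists U => //=.
  by apply: eq_eseriesr => j _; rewrite /hausdorff_weight Ud.
apply: le_ereal_inf_tmp => _ [U [Ud SU] <-].
apply: (le_trans (cover_outer_le _ SU)).
by apply: lee_nneseries => [j _ _|j _];
  [exact: hausdorff_weight_ge0|rewrite /hausdorff_weight Ud].
Qed.

End hausdorff_weight.

(** * Comparison of Hausdorff premeasures with Lebesgue measure *)

Section hausdorff_lebesgue.
Context {R : realType} {n : nat}.
Local Open Scope ereal_scope.
Implicit Types (A U S : set 'rV[R]_n.+1).

Lemma lebesgue_le_hausdorff_pre delta A : measurable A ->
  lebesgue_rV n.+1 A <= hausdorff_pre n.+1 delta A.
Proof.
move=> mA; apply: le_ereal_inf_tmp => _ [U [Ud AU] <-].
(* Covering sets are arbitrary, while the isodiametric inequality needs measurable ones; [fuzz]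
   enlarges them without increasing the diameter. *)
have AfU : A `<=` \bigcup_i fuzz (U i).
  by move=> x /AU[i _ Ux]; exists i => //; exact: sub_fuzz.
apply: (le_trans (measure_sigma_subadditive (lebesgue_rV n.+1)
  (fun i => measurable_fuzz (U i)) mA AfU)).
apply: lee_nneseries => // i _.
have := ediam_ge0 (U i); have := Ud i; case E : (ediam (U i)) => [D||]//.
rewrite !lee_fin => Dd D0.
have UD : diam_le D (U i) by apply/(ediam_leP _ D0); rewrite E.
apply: (le_trans (isodiametric D0 (measurable_fuzz _) (diam_le_fuzz UD))).
by rewrite -EFin_expe -EFinM lee_fin expr_div_n mulrA mulrAC.
Qed.

Lemma cvg_bigprod (F : set_system R) {FF : Filter F} I (s : seq I)
    (f : I -> R -> R) (l : I -> R) :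
  (forall i, f i x @[x --> F] --> l i) ->
  ((\prod_(i <- s) f i x)%R @[x --> F] --> (\prod_(i <- s) l i)%R).
Proof.
move=> fl; elim: s => [|i s IH].
  by under eq_fun do rewrite big_nil; rewrite big_nil; exact: cvg_cst.
by under eq_fun do rewrite big_cons; rewrite big_cons; exact: cvgM.
Qed.

Variable delta : R.
Hypothesis delta0 : (0 < delta)%R.

Local Notation H := (cover_outer (@hausdorff_weight R n.+1 n.+1 delta)).

Let H0 : H set0 = 0.
Proof.
apply: cover_outer0; first exact: hausdorff_weight_ge0.
by apply: hausdorff_weight0; exact: ltW.
Qed.

Let H_ge0 A : 0 <= H A.
Proof. by apply: cover_outer_ge0; exact: hausdorff_weight_ge0. Qed.

Let H_sub : sigma_subadditive H.
Proof. by apply: cover_outer_sigma_subadditive; exact: hausdorff_weight_ge0. Qed.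

(** The cubes of side [s] meeting the box are disjoint and lie in the box enlarged by [s] on every
    side. The volume [q s] of the enlarged box tends to that of the box as [s] tends to 0. *)
Lemma hausdorff_box_bound (C s0 : R) : (0 < C)%R -> (0 < s0)%R ->
  (forall s (k : 'rV[int]_n.+1), (0 < s < s0)%R -> H (cell s k) <= (C * s ^+ n.+1)%:E) ->
  forall a b : 'rV[R]_n.+1, H (box a b) <= C%:E * lebesgue_rV n.+1 (box a b).
Proof.
move=> C0 s00 HC a b.
have [ab|/existsNP[i /negP]] := pselect (forall i, a ord0 i < b ord0 i)%R; last first.
  rewrite -leNgt => ba; rewrite (box_empty ba) H0.
  by rewrite measure0 mule0.
pose q s := (\prod_i (b ord0 i - a ord0 i + 2 * s))%R.
have Hq s : (0 < s < s0)%R -> H (box a b) <= (C * q s)%:E.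
  move=> ss0; have /andP[s_gt0 _] := ss0.
  apply: (@le_trans _ _ (\sum_(m <oo) H (cells_meeting s (box a b) m))).
    by apply: le_trans (H_sub _); apply: cover_outer_mono; exact: cells_meeting_cover.
  apply: (@le_trans _ _ (\sum_(m <oo) C%:E * lebesgue_rV n.+1 (cells_meeting s (box a b) m))).
    apply: lee_nneseries => // m _; rewrite /cells_meeting; case: ifP => _; last first.
      by rewrite H0 measure0 mule0.
    rewrite /cells; case: pickle_inv => [k|]; last by rewrite H0 measure0 mule0.
    by rewrite lebesgue_cell ?(ltW s_gt0)// -EFinM HC.
  rewrite nneseriesZl// EFinM lee_pmul2l// -measure_semi_bigcup; last 3 first.
    - by move=> m; exact: measurable_cells_meeting.
    - exact: trivIset_cells_meeting.
    - by apply: bigcupT_measurable => m; exact: measurable_cells_meeting.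
  apply: (@le_trans _ _ (lebesgue_rV n.+1
    (box (\row_i (a ord0 i - s)%R) (\row_i (b ord0 i + s)%R)))).
    apply: le_measure; rewrite ?inE.
    - by apply: bigcupT_measurable => m; exact: measurable_cells_meeting.
    - exact: measurable_box.
    - move=> x [m _]; rewrite /cells_meeting; case: asboolP => // -[y []].
      rewrite /cells; case: pickle_inv => // k ky yab kx i; rewrite !mxE.
      have := ky i; have := yab i; have := kx i; rewrite !mxE mulrDr mulr1.
      by move=> /andP[? ?] /andP[? ?] /andP[? ?]; apply/andP; split; lra.
  rewrite lebesgue_rV_box => [|i]; last by rewrite !mxE; have := ab i; lra.
  rewrite le_eqVlt; apply/orP; left; apply/eqP; congr EFin.
  by apply: eq_bigr => i _; rewrite !mxE; ring.
rewrite lebesgue_rV_box => [|i]; last exact: ltW.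
rewrite -EFinM.
have cq : (C * q s)%R @[s --> 0%R] --> (C * \prod_i (b ord0 i - a ord0 i))%R.
  apply: cvgM; first exact: cvg_cst.
  apply: (@cvg_bigprod _ _ _ _ (fun i s => b ord0 i - a ord0 i + 2 * s)%R
    (fun i => b ord0 i - a ord0 i)%R) => i.
  rewrite -[X in _ --> X]addr0 -[X in _ --> (_ + X)%R](mulr0 2%R).
  by apply: cvgD; [exact: cvg_cst|apply: cvgM; [exact: cvg_cst|exact: cvg_id]].
rewrite leNgt; apply/negP => lt.
have s1 : (0 < s0 / 2 < s0)%R by lra.
have finH : H (box a b) \is a fin_num.
  by rewrite ge0_fin_numE// (le_lt_trans (Hq _ s1))// ltry.
move: lt; rewrite -(fineK finH) lte_fin => lt.
have : \forall s \near 0%R^'+, (C * q s < fine (H (box a b)))%R.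
  exact: (cvgr_lt _ (cvg_at_right_filter cq)).
move=> /(filterI (nbhs_right_gt 0%R)) /(filterI (nbhs_right_lt s00)).
move=> /filter_ex[s [/= ss0 [/= sgt0]]].
by apply/negP; rewrite -leNgt -lee_fin fineK//; apply: Hq; rewrite sgt0 ss0.
Qed.

(** From small cubes to boxes, then to Borel sets by covering them with boxes of nearly the same
    total volume. It reduces every later bound to a single small cube. *)
Lemma hausdorff_cell_bound (C s0 : R) : (0 < C)%R -> (0 < s0)%R ->
  (forall s (k : 'rV[int]_n.+1), (0 < s < s0)%R -> H (cell s k) <= (C * s ^+ n.+1)%:E) ->
  forall A, measurable A -> H A <= C%:E * lebesgue_rV n.+1 A.
Proof.
move=> C0 s00 HC A mA.
rewrite -lee_pdivrMl//; apply: le_trans (box_outer_le_lebesgue mA).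
apply: cover_outer_ge => U AU; rewrite lee_pdivrMl// -nneseriesZl => [|*]; last first.
  exact: box_weight_ge0.
apply: (le_trans (cover_outer_mono _ AU)); apply: (le_trans (H_sub _)).
apply: lee_nneseries => // i _.
rewrite /box_weight; case: asboolP => [[a [b ->]]|_].
  exact: (hausdorff_box_bound C0 s00).
by rewrite gt0_muley ?lte_fin// leey.
Qed.

(** Both the normalization constant of Hausdorff measure and the ratio of the volume of a ball to
    that of its circumscribed cube. *)
Let c : R := (unit_ball_volume n.+1 / 2 ^+ n.+1)%R.

(** A cube of side [s] covers itself and has diameter at most [s (n + 1)], whence the constant. The
    threshold [delta / (n + 1)] makes this covering admissible. *)
Lemma hausdorff_rough_bound : exists2 C : R, (0 < C)%R &
  forall A, measurable A -> H A <= (1 + C)%:E * lebesgue_rV n.+1 A.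
Proof.
exists (c * n.+1%:R ^+ n.+1)%R.
  by rewrite mulr_gt0 ?ball_ratio_gt0// exprn_gt0.
apply: (@hausdorff_cell_bound _ (delta / n.+1%:R)).
- by rewrite addr_gt0// mulr_gt0 ?ball_ratio_gt0// exprn_gt0.
- by rewrite divr_gt0.
move=> s k /andP[s0 sd]; apply: (@le_trans _ _ (hausdorff_weight n.+1 delta (cell s k))).
  apply: cover_outer_weight; first exact: hausdorff_weight_ge0.
  by apply: hausdorff_weight0; exact: ltW.
apply: (@le_trans _ _ (c * (s *+ n.+1) ^+ n.+1)%:E).
  apply: hausdorff_weight_le => [|x y]; last exact: cell_diam (ltW s0).
  by rewrite mulrn_wge0 ?(ltW s0)//= -mulr_natr -ler_pdivlMr// ltW.
rewrite lee_fin -[(s *+ _)%R]mulr_natl exprMn mulrA ler_wpM2r ?exprn_ge0 ?(ltW s0)//.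
by rewrite lerDr.
Qed.

Definition cell_center (s : R) (k : 'rV[int]_n.+1) : 'rV[R]_n.+1 :=
  (\row_i (s * ((k ord0 i)%:~R + 2^-1)))%R.

Lemma horizon_sub_cell s (k : 'rV[int]_n.+1) :
  horizon (s / 2) (cell_center s k) `<=` cell s k.
Proof.
move=> x; rewrite /horizon/= => xs i.
have := le_lt_trans (coord_le_enorm _ i) xs.
rewrite !mxE ltr_norml !mulrDr mulr1 => /andP[? ?]; apply/andP; split; lra.
Qed.

Lemma lebesgue_horizon_half s (x : 'rV[R]_n.+1) : (0 < s)%R ->
  lebesgue_rV n.+1 (horizon (s / 2) x) = (c * s ^+ n.+1)%:E.
Proof.
move=> s0; rewrite lebesgue_horizon ?divr_gt0// expr_div_n; congr EFin.
by rewrite /c mulrA mulrAC.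
Qed.

Let c_le1 : (c <= 1)%R.
Proof.
have : lebesgue_rV n.+1 (horizon (1 / 2) (cell_center 1 0)) <=
    lebesgue_rV n.+1 (cell (1 : R)%R 0).
  apply: le_measure; rewrite ?inE; [exact: measurable_horizon|exact: measurable_cell|].
  exact: horizon_sub_cell.
by rewrite lebesgue_horizon_half// lebesgue_cell// lee_fin expr1n mulr1.
Qed.

(* A small cube is covered by its inscribed ball, which costs at most its volume
   because its diameter is the side of the cube, and by the rest. *)
Lemma hausdorff_improve (C : R) : (0 <= C)%R ->
  (forall A, measurable A -> H A <= (1 + C)%:E * lebesgue_rV n.+1 A) ->
  forall A, measurable A -> H A <= (1 + C * (1 - c))%:E * lebesgue_rV n.+1 A.
Proof.
move=> C0 HC; apply: (@hausdorff_cell_bound _ delta) => //.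
  by rewrite ltr_pwDl// mulr_ge0// subr_ge0.
move=> s k /andP[s0 sd]; set B := horizon (s / 2) (cell_center s k).
have mB : measurable B by exact: measurable_horizon.
have mD : measurable (cell s k `\` B) by apply: measurableD => //; exact: measurable_cell.
have cellE : cell s k = B `|` (cell s k `\` B) by rewrite setDUK//; exact: horizon_sub_cell.
have lD : lebesgue_rV n.+1 (cell s k `\` B) = (s ^+ n.+1 - c * s ^+ n.+1)%:E.
  have := lebesgue_cell k (ltW s0); rewrite {1}cellE measureU//; last by rewrite setDIK.
  rewrite [X in X + _ = _](_ : _ = (c * s ^+ n.+1)%:E); last exact: lebesgue_horizon_half.
  by move=> e; rewrite EFinB -e addeAC subee// add0e.
apply: (@le_trans _ _ (H B + H (cell s k `\` B))).
  rewrite {1}cellE; apply: cover_outerU; first exact: hausdorff_weight_ge0.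
  by apply: hausdorff_weight0; exact: ltW.
(* The gain is [c + (1 + C)(1 - c) = 1 + C (1 - c)], in units of [s^(n+1)]. *)
apply: (@le_trans _ _ ((c * s ^+ n.+1)%:E + (1 + C)%:E * (s ^+ n.+1 - c * s ^+ n.+1)%:E)).
  apply: leeD; last by rewrite -lD; exact: HC.
  apply: (@le_trans _ _ (hausdorff_weight n.+1 delta B)).
    apply: cover_outer_weight; first exact: hausdorff_weight_ge0.
    by apply: hausdorff_weight0; exact: ltW.
  apply: hausdorff_weight_le; first by rewrite (ltW s0) (ltW sd).
  move=> x y; rewrite /B /horizon/= => xB yB.
  have := enormB_trans (cell_center s k) x y; rewrite (enormBC (cell_center s k) y); lra.
by rewrite -EFinM -EFinD lee_fin le_eqVlt; apply/orP; left; apply/eqP; ring.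
Qed.

(** Iterating [hausdorff_improve] from the rough bound leaves an excess [C (1 - c)^N], which tends
    to 0 because [0 < c <= 1]. *)
Lemma hausdorff_pre_le_lebesgue A : measurable A -> H A <= lebesgue_rV n.+1 A.
Proof.
move=> mA; have [C C0 HC] := hausdorff_rough_bound.
have c1 : (0 <= 1 - c)%R by rewrite subr_ge0.
have HN N : forall A, measurable A ->
    H A <= (1 + C * (1 - c) ^+ N)%:E * lebesgue_rV n.+1 A.
  elim: N => [|N IH]; first by rewrite expr0 mulr1.
  rewrite exprSr mulrA; apply: hausdorff_improve => //.
  by rewrite mulr_ge0 ?exprn_ge0// ltW.
have : 0 <= lebesgue_rV n.+1 A by exact: measure_ge0.
case E : (lebesgue_rV n.+1 A) => [l||] l0; [|exact: leey|by rewrite leeNy_eq in l0].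
have HN' N : H A <= (l + C * l * (1 - c) ^+ N)%:E.
  apply: le_trans (HN N _ mA) _; rewrite E -EFinM lee_fin le_eqVlt.
  by apply/orP; left; apply/eqP; ring.
rewrite leNgt; apply/negP => lt.
have finH : H A \is a fin_num by rewrite ge0_fin_numE// (le_lt_trans (HN' 0%N))// ltry.
move: lt; rewrite -(fineK finH) lte_fin => lt.
have cN : (fun N => l + C * l * (1 - c) ^+ N)%R @ \oo --> (l + C * l * 0)%R.
  apply: cvgD; first exact: cvg_cst.
  apply: cvgM; first exact: cvg_cst.
  apply: cvg_expr; rewrite ger0_norm// ltrBlDr ltrDl; exact: ball_ratio_gt0.
rewrite mulr0 addr0 in cN.
have /filter_ex[N] : \forall N \near \oo, (l + C * l * (1 - c) ^+ N < fine (H A))%R.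
  exact: (cvgr_lt _ cN).
by apply/negP; rewrite -leNgt -lee_fin fineK//; exact: HN'.
Qed.

End hausdorff_lebesgue.

Theorem hausdorff_measure_lebesgue {R : realType} n (A : set 'rV[R]_n.+1) :
  measurable A -> hausdorff_measure n.+1 A = lebesgue_rV n.+1 A.
Proof.
move=> mA; apply/eqP; rewrite eq_le; apply/andP; split.
  apply: ge_ereal_sup => _ [delta delta0 <-]; rewrite hausdorff_preE.
  exact: hausdorff_pre_le_lebesgue.
apply: (le_trans (lebesgue_le_hausdorff_pre 1 mA)).
by apply: ereal_sup_ubound; exists 1%R => //=; exact: ltr01.
Qed.

(** * Segments crossing a hyperplane *)

Section plane.
Context {R : realType}.

Lemma expe_le (x y : \bar R) k : (0 <= x)%E -> (x <= y)%E -> (x ^+ k <= y ^+ k)%E.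
Proof.
move=> x0 xy; elim: k => [|k IH]; first by rewrite !expe0.
by rewrite !expeS lee_pmul// expe_ge0.
Qed.

Lemma hausdorff_pre_transfer a b k delta (A : set 'rV[R]_a) (B : set 'rV[R]_b)
    (Phi : set 'rV[R]_a -> set 'rV[R]_b) :
  (forall U, ediam (Phi U) <= ediam U)%E ->
  (forall U : nat -> set 'rV[R]_a, A `<=` \bigcup_i U i -> B `<=` \bigcup_i Phi (U i)) ->
  (hausdorff_pre k delta B <= hausdorff_pre k delta A)%E.
Proof.
move=> Phid PhiAB; apply: le_ereal_inf_tmp => _ [U [Ud AU] <-].
apply: (@le_trans _ _ (\sum_(0 <= i <oo)
  (unit_ball_volume k / 2 ^+ k)%:E * ediam (Phi (U i)) ^+ k)%E).
  apply: ereal_inf_lbound; exists (fun i => Phi (U i)) => //.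
  by split=> [i|]; [exact: le_trans (Ud i)|exact: PhiAB].
have c0 : (0 <= (unit_ball_volume k / 2 ^+ k : R)%:E)%E.
  by rewrite lee_fin ltW// ball_ratio_gt0.
apply: lee_nneseries => [i _ _|i _].
  by rewrite mule_ge0// expe_ge0// ediam_ge0.
by rewrite lee_wpmul2l// expe_le// ediam_ge0.
Qed.

Lemma le_ediam a b (U : set 'rV[R]_a) (V : set 'rV[R]_b) :
  (forall x y, U x -> U y ->
    exists x' y', [/\ V x', V y' & enorm (x - y) = enorm (x' - y')]) ->
  (ediam U <= ediam V)%E.
Proof.
move=> UV; rewrite {1}/ediam ge_max ediam_ge0/=.
apply: ge_ereal_sup => _ [[x y] [Ux Uy] <-]/=.
have [x' [y' [Vx Vy ->]]] := UV x y Ux Uy.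
rewrite /ediam le_max; apply/orP; right; apply: ereal_sup_ubound => /=.
by exists (x', y').
Qed.

(** Coverings are transported by images in one direction and by preimages in the other, neither of
    which increases diameters. The normalization depends only on [k], so the ambient dimensions may
    differ; this takes a hyperplane piece to its chart. *)
Lemma hausdorff_measure_isometry a b k (f : 'rV[R]_a -> 'rV[R]_b) (A : set 'rV[R]_a) :
  (forall x y, enorm (f x - f y) = enorm (x - y)) ->
  hausdorff_measure k (f @` A) = hausdorff_measure k A.
Proof.
move=> fiso; rewrite /hausdorff_measure; congr ereal_sup.
suff E delta : hausdorff_pre k delta (f @` A) = hausdorff_pre k delta A.
  by apply/seteqP; split => _ [delta d0 <-]; exists delta.
apply/eqP; rewrite eq_le; apply/andP; split.
  apply: (@hausdorff_pre_transfer _ _ _ _ _ _ (fun U => f @` U)) => [U|U AU _ [x Ax <-]].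
    apply: le_ediam => _ _ [x Ux <-] [y Uy <-].
    by exists x, y; split => //; exact: fiso.
  by have [i _ Ux] := AU x Ax; exists i => //; exists x.
apply: (@hausdorff_pre_transfer _ _ _ _ _ _ (fun U => f @^-1` U)) => [U|U AU x Ax].
  by apply: le_ediam => x y Ux Uy; exists (f x), (f y).
by have [i _ Ux] := AU (f x) (imageP f Ax); exists i.
Qed.

Lemma dotp_orthogonal n (O : 'M[R]_n) (x y : 'rV[R]_n) : O *m O^T = 1%:M ->
  dotp (x *m O) (y *m O) = dotp x y.
Proof. by move=> OO; rewrite !dotpE trmx_mul -mulmxA (mulmxA O) OO mul1mx. Qed.

Lemma outer_mul n (x w : 'rV[R]_n) : x *m (w^T *m w) = dotp x w *: w.
Proof. by rewrite mulmxA [x *m _]mx11_scalar -dotpE mul_scalar_mx. Qed.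

(* The Householder reflection exchanging u and v *)
Lemma exists_orthogonal n (u v : 'rV[R]_n) : enorm u = enorm v ->
  exists2 O : 'M[R]_n, O *m O^T = 1%:M & u *m O = v.
Proof.
move=> uv; have [->|neq] := eqVneq u v; first by exists 1%:M; rewrite ?trmx1 ?mulmx1.
pose w := u - v.
have w0 : dotp w w != 0.
  by apply/eqP => /dotp_eq0/eqP; rewrite subr_eq0 (negbTE neq).
pose a := 2 / dotp w w.
(* Equality of the norms gives [u . w = |w|^2 / 2], so the reflection takes [u] to [u - w = v]. *)
have uw : dotp u w = dotp w w / 2.
  have := congr1 (fun x => x ^+ 2) uv; rewrite !enorm_sqr => uuvv.
  by rewrite /w -scaleN1r dotpDl !dotpDr !dotpZl !dotpZr (dotpC v u) -uuvv; field.
exists (1%:M - a *: (w^T *m w) : 'M[R]_n); last first.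
  rewrite mulmxBr mulmx1 -scalemxAr outer_mul scalerA uw /a.
  rewrite (_ : 2 / dotp w w * (dotp w w / 2) = 1); last by field.
  by rewrite scale1r /w opprB addrC subrK.
have -> : (1%:M - a *: (w^T *m w))^T = 1%:M - a *: (w^T *m w).
  by rewrite linearB/= trmx1 linearZ/= trmx_mul trmxK.
have PP : w^T *m w *m (w^T *m w) = dotp w w *: (w^T *m w).
  by rewrite -mulmxA outer_mul -scalemxAr.
move: PP; set P := w^T *m w; move: P => P PP.
rewrite mulmxBl mul1mx mulmxBr mulmx1 -!scalemxAl -!scalemxAr PP !scalerA.
rewrite (_ : a * a * dotp w w = a + a); last by rewrite /a; field.
by rewrite scalerDl opprB addrK subrK.
Qed.

(** The signed height over the hyperplane is affine along the segment, so the meeting point has the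
    explicit parameter [a / (a - b)], with [a] and [b] the heights of the end points. Removing the
    existential makes crossing a measurable condition. *)
Lemma crossesP n (p nu : 'rV[R]_n) (S : set 'rV[R]_n) x y : S `<=` hyperplane p nu ->
  crosses p nu S x y <-> (dotp nu (x - p) * dotp nu (y - p) < 0 /\
    S (x + (dotp nu (x - p) / (dotp nu (x - p) - dotp nu (y - p))) *: (y - x))).
Proof.
move=> Sp; rewrite /crosses.
have side s : dotp nu (x + s *: (y - x) - p) =
    dotp nu (x - p) - s * (dotp nu (x - p) - dotp nu (y - p)).
  rewrite (_ : x + _ - p = (x - p) + s *: ((y - p) - (x - p))); last first.
    by rewrite opprB [y - p + _]addrA subrK addrAC.
  by rewrite dotpDr dotpZr [dotp nu (y - p - _)]dotpDr dotpNr; ring.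
set a := dotp nu (x - p) in side *; set b := dotp nu (y - p) in side *.
split=> -[ab]; (have ba : a - b != 0
  by rewrite subr_eq0; apply/eqP => E; move: ab; rewrite E -expr2 ltNge sqr_ge0).
  move=> [s s01 Ss]; split=> //.
  have := Sp _ Ss; rewrite /hyperplane/= side => /eqP; rewrite subr_eq0 => /eqP aE.
  by rewrite {1}aE mulfK.
move=> Ss; split=> //; exists (a / (a - b)) => //.
have [a0|a0|a0] := ltgtP a 0; last by rewrite a0 mul0r ltxx in ab.
- have b0 : 0 < b by rewrite nmulr_rlt0 in ab.
  by rewrite ler_ndivlMr ?ler_ndivrMr; lra.
- have b0 : b < 0 by rewrite pmulr_rlt0 in ab.
  by rewrite ler_pdivlMr ?ler_pdivrMr; lra.
Qed.

Lemma measurable_crosses n (p nu : 'rV[R]_n) (S : set 'rV[R]_n)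
    d (T : measurableType d) (f g : T -> 'rV[R]_n) :
  S `<=` hyperplane p nu -> measurable S ->
  measurable_fun setT f -> measurable_fun setT g ->
  measurable [set z | crosses p nu S (f z) (g z)].
Proof.
move=> Sp mS mf mg.
have ma (h : T -> 'rV[R]_n) : measurable_fun setT h ->
    measurable_fun setT (fun z => dotp nu (h z - p)).
  by move=> mh; apply: measurable_dotp => //; exact: measurable_rVB.
rewrite (_ : mkset _ =
  ((fun z => dotp nu (f z - p) * dotp nu (g z - p)) @^-1` `]-oo, 0[) `&`
  ((fun z => f z + (dotp nu (f z - p) / (dotp nu (f z - p) - dotp nu (g z - p))) *:
     (g z - f z)) @^-1` S)); last first.
  apply/seteqP; split=> z /=; rewrite in_itv/= => h; first exact/crossesP.
  by apply/crossesP.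
apply: measurableI; apply: measurable_preimage => //.
  by apply: measurable_funM; exact: ma.
apply: measurable_rVD => //; apply: measurable_rVZ; last exact: measurable_rVB.
apply: measurable_funM; first exact: ma.
by apply: measurable_funV; apply: measurable_funB; exact: ma.
Qed.

(** The heights [t] from which a bond of normal component [h] reaches the other side: the open
    interval between 0 and [- h]. *)
Definition crossing_params (h : R) := [set t : R | t * (t + h) < 0].

Lemma lebesgue_crossing_params (h : R) :
  lebesgue_measure (crossing_params h) = `|h|%:E.
Proof.
have [h0|h0|->] := ltgtP h 0.
- rewrite (_ : crossing_params h = `]0, (- h)[%classic).
    by rewrite lebesgue_measure_itv/= lte_fin oppr_gt0 h0 -EFinB subr0 ltr0_norm.
  apply/seteqP; split => t; rewrite /crossing_params/= in_itv/=; last first.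
    by move=> /andP[t0 th]; rewrite pmulr_rlt0//; lra.
  have [t0|t0|->] := ltgtP t 0; last by rewrite mul0r ltxx.
    by rewrite nmulr_rlt0// => th; lra.
  by rewrite pmulr_rlt0// => th; lra.
- rewrite (_ : crossing_params h = `](- h), 0[%classic).
    by rewrite lebesgue_measure_itv/= lte_fin oppr_lt0 h0 -EFinB sub0r opprK gtr0_norm.
  apply/seteqP; split => t; rewrite /crossing_params/= in_itv/=; last first.
    by move=> /andP[t0 th]; rewrite nmulr_rlt0//; lra.
  have [t0|t0|->] := ltgtP t 0; last by rewrite mul0r ltxx.
    by rewrite nmulr_rlt0// => th; apply/andP; split; lra.
  by rewrite pmulr_rlt0// => th; lra.
- rewrite normr0 (_ : crossing_params 0 = set0) ?measure0//.
  apply/seteqP; split => // t; rewrite /crossing_params/= addr0 -expr2.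
  by rewrite ltNge sqr_ge0.
Qed.

Lemma measurable_crossing_params h : measurable (crossing_params h).
Proof.
rewrite (_ : crossing_params h = (fun t => t * (t + h)) @^-1` `]-oo, 0[).
  apply: measurable_preimage => //.
  apply: measurable_funM => //.
  exact: measurable_funD.
by apply/seteqP; split => t; rewrite /= in_itv.
Qed.

Variables (n : nat) (O : 'M[R]_n.+1) (p nu : 'rV[R]_n.+1).
Hypothesis OO : O *m O^T = 1%:M.
Hypothesis Onu : rV_cons (1, 0) *m O = nu.

(** [O] sends the first basis vector to [nu], hence the others to an orthonormal basis of the
    directions of the hyperplane. *)
Definition plane_chart (v : 'rV[R]_n) : 'rV[R]_n.+1 := p + rV_cons (0, v) *m O.

Lemma dotp_normal (y : 'rV[R]_n.+1) : dotp nu (y *m O) = y ord0 ord0.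
Proof.
rewrite -Onu dotp_orthogonal//; have [t [v ->]] := rV_consP y.
by rewrite dotp_cons rV_cons_coord0 mul1r dotpC dotp0r addr0.
Qed.

Let OtO : O^T *m O = 1%:M. Proof. exact: mulmx1C. Qed.

Lemma hyperplane_chart (S : set 'rV[R]_n.+1) : S `<=` hyperplane p nu ->
  S = plane_chart @` (plane_chart @^-1` S).
Proof.
move=> Sp; apply/seteqP; split => [x Sx|_ [v Sv <-]//].
have [t [v xE]] := rV_consP ((x - p) *m O^T).
have xE' : x - p = rV_cons (t, v) *m O by rewrite -xE -mulmxA OtO mulmx1.
have t0 : t = 0.
  by have := Sp x Sx; rewrite /hyperplane/= xE' dotp_normal rV_cons_coord0.
suff xv : plane_chart v = x by exists v => //=; rewrite xv.
by rewrite /plane_chart -t0 -xE' addrC subrK.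
Qed.

Lemma plane_chart_isometry x y : enorm (plane_chart x - plane_chart y) = enorm (x - y).
Proof.
rewrite /plane_chart opprD addrACA subrr add0r -mulmxBl enorm_orthogonal//.
by rewrite enorm_consB subrr expr0n add0r sqrtr_sqr ger0_norm// enorm_ge0.
Qed.

Lemma measurable_plane_chart : measurable_fun setT plane_chart.
Proof.
apply: measurable_rVD => //; apply: measurable_rV_mulmx.
exact: measurable_rV_consf.
Qed.

(** In coordinates (height, position along the plane) the bond meets the plane at parameter
    [- t / h]. If [h = 0] both sides are false, so the value of [t / 0] is irrelevant. *)
Lemma crossesE (S : set 'rV[R]_n.+1) t (v : 'rV[R]_n) h (e : 'rV[R]_n) :
  S `<=` hyperplane p nu ->
  crosses p nu S (p + rV_cons (t, v) *m O) (p + rV_cons (t, v) *m O + rV_cons (h, e) *m O) <->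
  crossing_params h t /\ (plane_chart @^-1` S) (v + (- (t / h)) *: e).
Proof.
move=> Sp; set x := p + _; set y := x + _.
have side z : dotp nu (p + z *m O - p) = z ord0 ord0 by rewrite addrAC subrr add0r dotp_normal.
have yE : y = p + rV_cons (t + h, v + e) *m O by rewrite /y /x -addrA -mulmxDl rV_consD.
have yx : y - x = rV_cons (h, e) *m O by rewrite /y [x + _]addrC addrK.
have pt s : x + s *: (rV_cons (h, e) *m O) = p + rV_cons (t + s * h, v + s *: e) *m O.
  by rewrite /x scalemxAl -addrA -mulmxDl rV_consZ rV_consD.
rewrite (crossesP _ _ Sp) yx pt yE !side !rV_cons_coord0 -/(crossing_params h t).
have [->|h0] := eqVneq h 0.
  have N : ~ crossing_params 0 t.
    by rewrite /crossing_params/= addr0 -expr2 ltNge sqr_ge0.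
  by split=> -[/N].
rewrite /plane_chart opprD addrA subrr sub0r invrN mulrN.
by rewrite mulNr divfK// subrr.
Qed.

(** Cavalieri: at each height in [crossing_params] the slice is a translate of the chart preimage of
    [S], and these heights have total length [|nu . xi|]. *)
Lemma lebesgue_crosses (S : set 'rV[R]_n.+1) xi :
  S `<=` hyperplane p nu -> measurable S ->
  (lebesgue_rV n.+1 [set x | crosses p nu S x (x + xi)] =
   lebesgue_rV n (plane_chart @^-1` S) * `|dotp nu xi|%:E)%E.
Proof.
move=> Sp mS.
have mQ (f : 'rV[R]_n.+1 -> 'rV[R]_n.+1) : measurable_fun setT f ->
    measurable [set x | crosses p nu S (f x) (f x + xi)].
  by move=> mf; apply: measurable_crosses => //; exact: measurable_rVD.
have mS' : measurable (plane_chart @^-1` S).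
  by apply: measurable_preimage => //; exact: measurable_plane_chart.
have [h [e xiE]] := rV_consP (xi *m O^T).
have xiE' : xi = rV_cons (h, e) *m O by rewrite -xiE -mulmxA OtO mulmx1.
have -> : dotp nu xi = h by rewrite xiE' dotp_normal rV_cons_coord0.
rewrite -(@lebesgue_rV_affine R n.+1 1 p)// ?oner_neq0//; last first.
  by apply: (mQ id).
rewrite normr1 expr1n mul1e -(lebesgue_rV_orthogonal OO)/=; last first.
  by apply: mQ; apply: measurable_rVD => //; exact: measurable_rVZ.
rewrite measure_integral_indic; last first.
  apply: (mQ (fun x => 1 *: (x *m O) + p)); apply: measurable_rVD => //.
  by apply: measurable_rVZ => //; exact: measurable_rV_mulmx.
rewrite lebesgue_rV_fubini1//; last first.
  apply: measurable_indicE; apply: (mQ (fun x => 1 *: (x *m O) + p)).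
  apply: measurable_rVD => //.
  by apply: measurable_rVZ => //; exact: measurable_rV_mulmx.
rewrite -lebesgue_crossing_params [X in (_ * X)%E]measure_integral_indic; last first.
  exact: measurable_crossing_params.
rewrite -ge0_integralZl//; last first.
  by apply: measurable_indicE; exact: measurable_crossing_params.
apply: eq_integral => t _.
have E v : crosses p nu S (1 *: (rV_cons (t, v) *m O) + p)
      (1 *: (rV_cons (t, v) *m O) + p + xi) <->
    crossing_params h t /\ (plane_chart @^-1` S) (v + (- (t / h)) *: e).
  by rewrite -crossesE// scale1r xiE' [_ + p]addrC.
have [th|nth] := pselect (crossing_params h t); last first.
  rewrite [X in (_ * X)%E](_ : _ = 0%E); last by rewrite indicE memNset.
  rewrite mule0; apply: integral0_eq => v _.
  by rewrite indicE memNset//= E => -[].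
rewrite [X in (_ * X)%E](_ : _ = 1%E); last by rewrite indicE mem_set.
rewrite mule1 [RHS]measure_integral_indic//.
rewrite -[RHS](@ge0_integral_shift R n (- (t / h) *: e))//; last exact: measurable_indicE.
apply: eq_integral => v _; rewrite !indicE; congr (_%:R%:E).
by apply: congr1; apply/idP/idP; rewrite !inE/= E; [case|].
Qed.

End plane.

(** * Radial integrals *)

Section radial.
Context {R : realType}.
Local Open Scope ereal_scope.
Local Notation mu := (@lebesgue_measure R).
Implicit Types (f g h : R -> R).

Lemma integral_linear (k a b : R) : (a <= b)%R ->
  \int[mu]_(x in `[a, b]) (k * x)%:E = (k / 2 * (b ^+ 2 - a ^+ 2))%:E.
Proof.
rewrite le_eqVlt => /orP[/eqP->|ab].
  by rewrite set_itv1 integral_set1 subrr mulr0.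
have dF x : is_derive x (1 : R)%R (fun x : R => k / 2 * x ^+ 2)%R (k * x)%R.
  rewrite (_ : (fun _ => _) = (k / 2)%R \*: ((id : R -> R) ^+ 2)%R).
    by apply: is_derive_eq; rewrite /GRing.scale/=; field.
  by apply/funext => y; rewrite /= exprfctE.
have cF : continuous (fun x : R => k / 2 * x ^+ 2)%R.
  by move=> x; apply: differentiable_continuous; apply/derivable1_diffP; apply: ex_derive.
rewrite (@continuous_FTC2 _ (fun x => k * x)%R (fun x => k / 2 * x ^+ 2)%R)//.
- by rewrite -EFinB mulrBr.
- by apply: continuous_subspaceT => x; apply: cvgM; [exact: cvg_cst|exact: cvg_id].
- split=> [x _||]; first exact: ex_derive.
  + exact/cvg_at_right_filter/cF.
  + exact/cvg_at_left_filter/cF.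
- by move=> x _; rewrite derive1E derive_val.
Qed.

Lemma integral_norm_id (c : R) : (0 <= c)%R ->
  \int[mu]_(x in `[(- c)%R, c]) (`|x|%R)%:E = (c ^+ 2)%:E.
Proof.
move=> c0.
have -> : `[(- c)%R, c]%classic = `[(- c)%R, 0%R]%classic `|` `]0%R, c]%classic.
  apply/seteqP; split => x /=; rewrite !in_itv/=.
    by move=> /andP[cx xc]; have [x0|x0] := leP x 0%R; [left|right]; rewrite ?cx ?x0.
  by move=> [/andP[? ?]|/andP[? ?]]; apply/andP; split; lra.
have mabs D : measurable_fun D (fun x : R => (`|x|%R)%:E).
  by apply/measurable_EFinP; exact: measurable_funTS.
rewrite ge0_integral_setU//; [|exact: mabs|]; last first.
  rewrite disj_set2E; apply/eqP/seteqP; split => x //=; rewrite !in_itv/=.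
  by move=> -[/andP[? ?] /andP[? ?]]; lra.
rewrite [X in _ + X]integral_itv_obnd_cbnd//.
rewrite [X in X + _](_ : _ = \int[mu]_(x in `[(- c)%R, 0%R]) (- 1 * x)%:E); last first.
  apply: eq_integral => x; rewrite inE/= in_itv/= => /andP[_ x0].
  by rewrite ler0_norm// mulN1r.
rewrite [X in _ + X](_ : _ = \int[mu]_(x in `[0%R, c]) (1 * x)%:E); last first.
  apply: eq_integral => x; rewrite inE/= in_itv/= => /andP[x0 _].
  by rewrite ger0_norm// mul1r.
rewrite !integral_linear ?oppr_le0// -EFinD; congr EFin; field.
by [].
Qed.

(** Nothing is asked at [a] and [b]: a level set of a merely monotone function may or may not
    contain its end point. *)
Lemma integral_squeeze f g (a b : R) : measurable_fun setT f ->
  (forall x, a < x < b -> f x = g x)%R ->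
  (forall x, ~~ (a <= x <= b) -> f x = 0)%R ->
  measurable_fun setT g ->
  \int[mu]_x (f x)%:E = \int[mu]_(x in `[a, b]) (g x)%:E.
Proof.
move=> mf fg f0 mg.
have mfE D : measurable_fun D (fun x => (f x)%:E).
  by apply/measurable_EFinP; exact: measurable_funTS.
have mgE D : measurable_fun D (fun x => (g x)%:E).
  by apply/measurable_EFinP; exact: measurable_funTS.
transitivity (\int[mu]_(x in `[a, b]) (f x)%:E).
  rewrite [RHS]integral_mkcond; apply: eq_integral => x _.
  rewrite patchE; case: ifPn => // /negP xab; rewrite f0//.
  by apply/negP => xab'; apply: xab; rewrite inE/= in_itv.
rewrite -!integral_itv_bndo_bndc// -!integral_itv_obnd_cbnd//.
by apply: eq_integral => x; rewrite inE/= in_itv/= => xab; rewrite fg.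
Qed.

Definition below h : set (R * R) := [set z | 0 <= z.2 < h z.1]%R.

Lemma measurable_below h : measurable_fun setT h -> measurable (below h).
Proof.
move=> mh; rewrite (_ : below h = (snd @^-1` `[0%R, +oo[) `&`
    ((fun z : R * R => (h z.1 - z.2)%R) @^-1` `]0%R, +oo[)).
  apply: measurableI; apply: measurable_preimage => //.
  by apply: measurable_funB => //; exact: measurableT_comp.
apply/seteqP; split => -[x s] /=; rewrite /below/= !in_itv/= !andbT subr_gt0.
  by move=> /andP[-> ->].
by move=> [-> ->].
Qed.

(** [h x] is the length of [[0, h x[]; then Tonelli. *)
Lemma layer_cake g h : measurable_fun setT g -> measurable_fun setT h ->
  (forall x, 0 <= g x)%R -> (forall x, 0 <= h x)%R ->
  \int[mu]_x (g x * h x)%:E = \int[mu]_s \int[mu]_x (g x * \1_(below h) (x, s))%:E.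
Proof.
move=> mg mh g0 h0.
transitivity (\int[mu]_x \int[mu]_s (g x * \1_(below h) (x, s))%:E).
  apply: eq_integral => x _.
  have mb : measurable `[0%R, h x[%classic by [].
  transitivity (\int[mu]_s ((g x)%:E * (\1_(`[0%R, h x[%classic) s : R)%:E)); last first.
    apply: eq_integral => s _; rewrite EFinM; congr (_ * _%:E); rewrite !indicE.
  rewrite ge0_integralZl//.
  - rewrite integral_indic// setIT [X in _ * X](_ : _ = (h x)%:E)//.
    apply: etrans (lebesgue_measure_itv `[0%R, h x[) _; rewrite /= lte_fin.
    by case: ltP (h0 x) => [hx _|hx0 hx]; rewrite ?sube0//; congr (_%:E); lra.
  - exact: measurable_indicE.
  - by rewrite lee_fin.
apply: (@fubini_tonelli _ _ _ _ R mu mu (fun z => (g z.1 * \1_(below h) z)%:E)).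
  apply/measurable_EFinP; apply: measurable_funM.
    by apply: measurableT_comp => //.
  by apply: measurable_indic; exact: measurable_below.
by move=> z; rewrite lee_fin mulr_ge0.
Qed.

Section nonincreasing.
Variable q : R -> R.
Hypothesis q_ge0 : forall r, (0 <= q r)%R.
Hypothesis q_noninc : {homo q : r s /~ (s <= r)%R}.
Hypothesis q0 : forall r, (1 <= r)%R -> q r = 0%R.

Let mq : measurable_fun setT q.
Proof. exact: nonincreasing_measurable. Qed.

Definition radius (rho t : R) : R := Num.sqrt (t ^+ 2 + rho ^+ 2).

(** The density of [|t| dt] in the variable [u = radius rho t]; the factor 2 accounts for the two
    signs of [t]. *)
Definition tail_id (rho u : R) : R := (2 * u * \1_(`]rho, +oo[%classic) u)%R.

Lemma measurable_radius rho : measurable_fun setT (radius rho).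
Proof.
by apply: measurable_fun_sqrt; exact: measurable_funD.
Qed.

Lemma measurable_tail_id rho : measurable_fun setT (tail_id rho).
Proof.
apply: measurable_funM; last exact: measurable_indic.
exact: measurable_funM.
Qed.

Lemma tail_id_ge0 rho u : (0 <= rho)%R -> (0 <= tail_id rho u)%R.
Proof.
move=> rho0; rewrite /tail_id indicE.
have [ru|] := boolP (u \in _); last by rewrite mulr0.
move: ru; rewrite inE/= in_itv/= andbT => ru.
by rewrite mulr1 mulr_ge0// (le_trans rho0)// ltW.
Qed.

(* Both sides are [a ^+ 2 - rho ^+ 2] when the level set of [q] ends at [a > rho]. *)
Lemma integral_radius_level (rho s : R) : (0 <= rho)%R ->
  \int[mu]_t (`|t| * \1_(below (q \o radius rho)) (t, s))%:E =
  \int[mu]_u (tail_id rho u * \1_(below q) (u, s))%:E.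
Proof.
move=> rho0.
have radius_ge0 t : (0 <= radius rho t)%R by exact: sqrtr_ge0.
pose L := [set r : R | 0 <= s < q r]%R.
have LE r : below q (r, s) = L r by [].
have LE' t : below (q \o radius rho) (t, s) = L (radius rho t) by [].
have Lle r r' : (r <= r')%R -> L r' -> L r.
  by move=> rr' /andP[s0 sq]; rewrite /L/= s0 (lt_le_trans sq)// q_noninc.
have zero : (forall r, (rho < r)%R -> ~ L r) ->
  \int[mu]_t (`|t| * \1_(below (q \o radius rho)) (t, s))%:E =
  \int[mu]_u (tail_id rho u * \1_(below q) (u, s))%:E.
  move=> Lrho; rewrite !integral0_eq// => u _.
    rewrite /tail_id !indicE; have [ru|] := boolP (u \in _); last by rewrite mulr0 mul0r.
    rewrite memNset ?mulr0//= LE; apply: Lrho.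
    by move: ru; rewrite inE/= in_itv/= andbT.
  (* At 0 the radius is [rho] itself, which may belong to [L], but there the factor [|t|]
     vanishes. *)
  have [->|u0] := eqVneq u 0%R; first by rewrite normr0 mul0r.
  rewrite indicE memNset ?mulr0// LE'; apply: Lrho.
  rewrite /radius -{1}(ger0_norm rho0) -sqrtr_sqr ltr_sqrt.
    by rewrite ltrDr lt_neqAle eq_sym sqrf_eq0 u0 sqr_ge0.
  by rewrite ltr_pwDl ?sqr_ge0// lt_neqAle eq_sym sqrf_eq0 u0 sqr_ge0.
have [L0|L0] := pselect (L 0%R); last first.
  apply: zero => r rr Lr; apply: L0; apply: Lle Lr.
  by rewrite (le_trans rho0)// ltW.
have L1 r : L r -> (r <= 1)%R.
  move=> /andP[s0 sq]; rewrite leNgt; apply/negP => /ltW r1.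
  by move: sq; rewrite q0// ltNge s0.
have supL : has_sup L by split; [exists 0%R|exists 1%R].
pose a := sup L.
have a_lt r : (r < a)%R -> L r.
  by move=> ra; have [r' Lr' /ltW] := sup_gt (proj1 supL) ra; move/Lle; exact.
have a_gt r : (a < r)%R -> ~ L r.
  by move=> ar Lr; move: ar; rewrite ltNge ub_le_sup//; case: supL.
have [arho|rhoa] := leP a rho.
  by apply: zero => r rr; apply: a_gt; exact: le_lt_trans rr.
have a0 : (0 < a)%R by exact: le_lt_trans rhoa.
have ar2 : (0 < a ^+ 2 - rho ^+ 2)%R by rewrite subr_gt0 ltrXn2r.
pose c := Num.sqrt (a ^+ 2 - rho ^+ 2).
have c0 : (0 <= c)%R by exact: sqrtr_ge0.
have c2 : (c ^+ 2 = a ^+ 2 - rho ^+ 2)%R by rewrite sqr_sqrtr// ltW.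
have mpair : measurable_fun setT (fun t : R => (t, s)).
  exact: measurable_fun_pair.
rewrite (@integral_squeeze _ (fun t => `|t|%R) (- c) c)//.
- rewrite (@integral_squeeze _ (fun u => 2 * u)%R rho a)//.
  + rewrite integral_norm_id// integral_linear ?(ltW rhoa)// c2.
    by rewrite divff// mul1r.
  + apply: measurable_funM; first exact: measurable_tail_id.
    apply: measurableT_comp mpair; apply: measurable_indic.
    exact: measurable_below.
  + move=> u /andP[ru ua]; rewrite /tail_id !indicE !mem_set ?mulr1//=.
      exact: a_lt.
    by rewrite in_itv/= ru.
  + move=> u; rewrite negb_and -!ltNge => /orP[ur|au].
      rewrite /tail_id indicE memNset ?mulr0 ?mul0r//= in_itv/= andbT => ru.
      by move: (lt_trans ur ru); rewrite ltxx.
    by rewrite indicE memNset ?mulr0//; exact: a_gt.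
  + exact: measurable_funM.
- apply: measurable_funM => //.
  apply: measurableT_comp mpair; apply: measurable_indic.
  by apply: measurable_below; apply: measurableT_comp => //; exact: measurable_radius.
- move=> t; rewrite -ltr_norml => tc; rewrite indicE mem_set ?mulr1// LE'; apply: a_lt.
  rewrite -(ger0_norm (ltW a0)) -sqrtr_sqr ltr_sqrt ?exprn_gt0// -ltrBrDr -c2.
  by rewrite -real_normK ?num_real// ltrXn2r.
- move=> t; rewrite -ler_norml -ltNge => tc; rewrite indicE memNset ?mulr0// LE'.
  apply: a_gt; rewrite -{1}(ger0_norm (ltW a0)) -sqrtr_sqr ltr_sqrt.
    by rewrite -ltrBlDr -c2 -[ltRHS]real_normK ?num_real// ltrXn2r.
  rewrite ltr_pwDl ?sqr_ge0// -real_normK ?num_real// exprn_gt0//.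
  exact: le_lt_trans tc.
Qed.

Lemma integral_radius (rho : R) : (0 <= rho)%R ->
  \int[mu]_t (`|t| * q (radius rho t))%:E = \int[mu]_u (tail_id rho u * q u)%:E.
Proof.
move=> rho0.
have mr : measurable_fun setT (q \o radius rho).
  by apply: measurableT_comp => //; exact: measurable_radius.
have mnorm : measurable_fun setT (fun t : R => `|t|%R) by [].
rewrite (layer_cake mnorm mr (fun t => normr_ge0 t) (fun t => q_ge0 _)).
rewrite (layer_cake (measurable_tail_id rho) mq (fun u => tail_id_ge0 u rho0) q_ge0).
by apply: eq_integral => s _; exact: integral_radius_level.
Qed.

(** Integrating over the first coordinate leaves [2 u q(u)] on [u > |v|]. Exchanging the integrals,
    the admissible [v] fill a ball of radius [u] in dimension [n], of volume
    [unit_ball_volume n * u^n]. This is the origin of the factor [2 omega_(d-1)] and of the power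
    [q^d] in the critical energy release rate, with [d = n + 1]. *)
Lemma integral_norm_coord n :
  \int[lebesgue_rV n.+1]_z (`|z ord0 ord0| * q (enorm z))%:E =
  (2 * unit_ball_volume n)%:E * \int[mu]_(u in `[0%R, 1%R]) (u ^+ n.+1 * q u)%:E.
Proof.
rewrite lebesgue_rV_fubini2; last 2 first.
- apply/measurable_EFinP; apply: measurable_funM.
    by apply: measurableT_comp => //; exact: (measurable_rV_coord (ord0 : 'I_n.+1)).
  by apply: measurableT_comp => //; exact: measurable_enorm.
- by move=> z; rewrite lee_fin mulr_ge0.
transitivity (\int[lebesgue_rV n]_v \int[mu]_u (tail_id (enorm v) u * q u)%:E).
  apply: eq_integral => v _; rewrite -integral_radius ?enorm_ge0//.
  by apply: eq_integral => t _; rewrite rV_cons_coord0 enorm_cons.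
have mtail : measurable_fun setT
    (fun z : 'rV[R]_n * R => (tail_id (enorm z.1) z.2 * q z.2)%:E).
  apply/measurable_EFinP; apply: measurable_funM; last exact: measurableT_comp.
  apply: measurable_funM; first exact: measurable_funM.
  rewrite (_ : (fun _ => _) = \1_([set z : 'rV[R]_n * R | enorm z.1 < z.2]%R)); last first.
    apply/funext => z; rewrite !indicE; congr (nat_of_bool _)%:R%R.
    by apply/idP/idP; rewrite !inE/= in_itv/= andbT.
  apply: measurable_indic.
  rewrite (_ : mkset _ = (fun z : 'rV[R]_n * R => z.2 - enorm z.1)%R @^-1` `]0%R, +oo[).
    apply: measurable_preimage => //; apply: measurable_funB => //.
    exact: measurable_enorm.
  by apply/seteqP; split => z; rewrite /= in_itv/= andbT subr_gt0.
rewrite (@fubini_tonelli _ _ _ _ R (lebesgue_rV n) mu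
  (fun z => (tail_id (enorm z.1) z.2 * q z.2)%:E))//; last first.
  by move=> z; rewrite lee_fin mulr_ge0// tail_id_ge0// enorm_ge0.
have w0 : (0 <= 2 * unit_ball_volume n :> R)%R.
  by rewrite mulr_ge0// ltW// unit_ball_volume_gt0.
rewrite -ge0_integralZl//; last 2 first.
- apply/measurable_EFinP/measurable_funTS; apply: measurable_funM; last exact: mq.
  exact: measurable_funX.
- by move=> u; rewrite /= in_itv/= => /andP[u0 _]; rewrite lee_fin mulr_ge0 ?exprn_ge0.
rewrite [RHS]integral_mkcond; apply: eq_integral => u _.
have [u0|u0] := leP u 0%R.
  rewrite integral0_eq => [|v _]; last first.
    rewrite /tail_id indicE memNset ?mulr0 ?mul0r//= in_itv/= andbT => vu.
    by move: (lt_le_trans vu u0); rewrite ltNge enorm_ge0.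
  rewrite patchE; case: ifPn => //; rewrite inE/= in_itv/= => /andP[u0' _].
  by rewrite (@le_anti _ _ u 0%R) ?u0 ?u0'// expr0n/= mul0r mule0.
transitivity (\int[lebesgue_rV n]_v ((2 * u * q u)%:E * (\1_(horizon u 0) v)%:E)).
  apply: eq_integral => v _; rewrite -EFinM; congr EFin.
  rewrite /tail_id mulrAC; congr (_ * _)%R; rewrite !indicE; congr (nat_of_bool _)%:R%R.
  by apply/idP/idP; rewrite !inE/= in_itv/= andbT /horizon/= subr0.
rewrite ge0_integralZl//; last 2 first.
- by apply: measurable_indicE; exact: measurable_horizon.
- by rewrite lee_fin !mulr_ge0// ltW.
rewrite [X in _ * X = _](_ : _ = (unit_ball_volume n * u ^+ n)%:E); last first.
  rewrite -(lebesgue_horizon (0 : 'rV[R]_n) u0) [RHS]measure_integral_indic//.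
  exact: measurable_horizon.
rewrite -EFinM patchE; case: ifPn => u1.
  by rewrite -EFinM exprS; congr EFin; ring.
rewrite q0 ?mulr0 ?mul0r// leNgt; apply/negP => lt1; move: u1.
by rewrite notin_setE; apply; rewrite /= in_itv/= (ltW u0) ltW.
Qed.

End nonincreasing.

End radial.

(** * The failure energy of a flat crack *)

Section energy.
Context {R : realType}.
Local Open Scope ereal_scope.

Section influence.
Variables (J : R -> R) (M : R).
Hypothesis hJ : influence_function J M.

(** [J] is constrained only on nonnegative arguments. Extending it to the left by [J 0] gives a
    function monotone on the whole line, hence measurable and fit for the radial integrals. *)
Definition truncJ (r : R) : R := J (Num.max r 0)%R.

Lemma truncJE r : (0 <= r)%R -> truncJ r = J r.
Proof. by move=> r0; rewrite /truncJ max_l. Qed.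

Lemma truncJ_ge0 r : (0 <= truncJ r)%R.
Proof. by case: hJ => J0 _ _ _ _; apply: J0; rewrite le_max lexx orbT. Qed.

Lemma truncJ_noninc : {homo truncJ : r s /~ (s <= r)%R}.
Proof.
case: hJ => _ Jd _ _ _ r s rs; apply: Jd; first by rewrite le_max lexx orbT.
by rewrite ge_max !le_max rs lexx !orbT.
Qed.

Lemma truncJ_eq0 r : (1 <= r)%R -> truncJ r = 0%R.
Proof.
move=> r1; case: hJ => _ _ _ _ J1; rewrite truncJE ?J1//.
exact: le_trans r1.
Qed.

Lemma truncJ_le r : (truncJ r <= M)%R.
Proof.
case: hJ => _ Jd _ <- _; apply: Jd => //; by rewrite le_max lexx orbT.
Qed.

Lemma measurable_truncJ : measurable_fun setT truncJ.
Proof. exact: nonincreasing_measurable truncJ_noninc. Qed.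

(** The bound by [M] on [[0, 1]] makes the integral finite, so that the real-valued integral in the
    release rate is its true value. *)
Lemma integral_truncJ k :
  \int[lebesgue_measure]_(u in `[0%R, 1%R]) (u ^+ k * truncJ u)%:E =
  (\int[lebesgue_measure]_(u in `[0%R, 1%R]) (u ^+ k * J u))%R%:E.
Proof.
have itv u : u \in `[0%R, 1%R]%classic -> (0 <= u <= 1)%R by rewrite inE/= in_itv.
have E : \int[lebesgue_measure]_(u in `[0%R, 1%R]) (u ^+ k * truncJ u)%:E =
    \int[lebesgue_measure]_(u in `[0%R, 1%R]) (u ^+ k * J u)%:E.
  by apply: eq_integral => u /itv/andP[u0 _]; rewrite truncJE.
rewrite /Rintegral -E fineK//.
have ge0 u : `[0%R, 1%R]%classic u -> 0 <= (u ^+ k * truncJ u)%:E.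
  by move=> /mem_set/itv/andP[u0 _]; rewrite lee_fin mulr_ge0 ?exprn_ge0// truncJ_ge0.
rewrite ge0_fin_numE; last exact: integral_ge0.
apply: (@le_lt_trans _ _ (\int[lebesgue_measure]_(u in `[0%R, 1%R]) cst M%:E u)).
  apply: ge0_le_integral => //.
  - apply/measurable_EFinP/measurable_funTS; apply: measurable_funM.
      exact: measurable_funX.
    exact: measurable_truncJ.
  - move=> u /mem_set/itv/andP[u0 u1]; rewrite lee_fin -[leRHS]mul1r ler_pM ?exprn_ge0//.
    + exact: truncJ_ge0.
    + exact: exprn_ile1.
    + exact: truncJ_le.
rewrite integral_cst// [X in _ * X](_ : _ = 1) ?mule1 ?ltry//.
by apply: etrans (lebesgue_measure_itv `[0%R, 1%R]) _; rewrite /= lte_fin ltr01 sube0.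
Qed.

End influence.

(** * Reduction to the whole space and evaluation of the energy *)

Section flat_crack.
Variables (n : nat) (Omega : set 'rV[R]_n.+1) (Cp : R) (J : R -> R) (M eps : R).
Variables (p nu : 'rV[R]_n.+1) (S : set 'rV[R]_n.+1).
Hypothesis Cp0 : (0 < Cp)%R.
Hypothesis hJ : influence_function J M.
Hypothesis eps0 : (0 < eps)%R.
Hypothesis hS : flat_piece p nu S.
Hypothesis S_interior : forall x, S x -> horizon eps x `<=` Omega.

Let Sp : S `<=` hyperplane p nu. Proof. by case: hS. Qed.
Let mS : measurable S. Proof. by case: hS. Qed.

Let K : R := (Cp / (eps * unit_ball_volume n.+1 * eps ^+ n.+1))%R.

Let K_ge0 : (0 <= K)%R.
Proof.
by rewrite divr_ge0 ?(ltW Cp0)// !mulr_ge0 ?exprn_ge0 ?(ltW eps0)// ltW// unit_ball_volume_gt0.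
Qed.

Let KJ_ge0 r : (0 <= K * truncJ J r)%R.
Proof. exact: (mulr_ge0 K_ge0 (truncJ_ge0 hJ _)). Qed.

Let density x y : R :=
  (K * truncJ J (enorm (y - x) / eps) * \1_[set z | crosses p nu S z.1 z.2] (x, y))%R.

Let density_far x y : (eps <= enorm (y - x))%R -> density x y = 0%R.
Proof.
move=> xy; rewrite /density (truncJ_eq0 hJ) ?mulr0 ?mul0r//.
by rewrite ler_pdivlMr// mul1r.
Qed.

(** A crossing bond shorter than [eps] meets [S] at a point less than [eps] away from both ends, so
    [S_interior] puts both ends in [Omega]. *)
Let density_out x y : ~ (Omega x /\ Omega y) -> density x y = 0%R.
Proof.
move=> xy; have [/density_far//|near] := leP eps (enorm (y - x)).
rewrite /density indicE memNset ?mulr0//= => -[_ [s /andP[s0 s1] Sz]].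
apply: xy; split; apply: (S_interior Sz); rewrite /horizon/=.
  rewrite opprD addrA subrr sub0r enormN enormZ ger0_norm//.
  by rewrite (le_lt_trans _ near)// ler_piMl// enorm_ge0.
rewrite opprD addrA -[X in enorm (X - _)]scale1r -scalerBl enormZ ger0_norm ?subr_ge0//.
by rewrite (le_lt_trans _ near)// ler_piMl ?enorm_ge0// lerBlDr lerDl.
Qed.

Let density_in x y : Omega x -> Omega y ->
  (rho Omega J eps y x * Cp * \1_(flat_crack_bonds Omega eps p nu S) (x, y) = density x y)%R.
Proof.
move=> Ox Oy; have e0 : (0 <= enorm (y - x) / eps)%R by rewrite divr_ge0 ?enorm_ge0// ltW.
have [far|near] := leP eps (enorm (y - x)).
  rewrite density_far// /rho -(truncJE J e0) (truncJ_eq0 hJ) ?mulr0 ?mul0r//.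
  by rewrite ler_pdivlMr// mul1r.
rewrite /density truncJE// /rho !indicE (mem_set Oy).
rewrite (_ : ((x, y) \in flat_crack_bonds Omega eps p nu S) =
    ((x, y) \in [set z | crosses p nu S z.1 z.2])).
  by rewrite /K mulr1n; congr (_ * _)%R; ring.
apply/idP/idP; rewrite !inE/=; first by case.
by move=> cr; split.
Qed.

Lemma failure_energy_density Gamma t :
  Gamma t = flat_crack_bonds Omega eps p nu S ->
  failure_energy Omega J Cp eps Gamma t =
  \int[lebesgue_rV n.+1]_x \int[lebesgue_rV n.+1]_y (density x y)%:E.
Proof.
move=> GammaE; rewrite /failure_energy integral_mkcond; apply: eq_integral => x _.
rewrite patchE; case: ifPn => [/set_mem Ox|/negP Ox]; last first.
  rewrite integral0_eq// => y _; rewrite density_out// => -[Ox' _].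
  by apply: Ox; rewrite inE.
rewrite integral_mkcond; apply: eq_integral => y _.
rewrite patchE; case: ifPn => [/set_mem Oy|/negP Oy].
  by rewrite /chi_plus GammaE density_in.
rewrite density_out// => -[_ Oy'].
by apply: Oy; rewrite inE.
Qed.

Lemma failure_energy_flat (O : 'M[R]_n.+1) Gamma t :
  O *m O^T = 1%:M -> rV_cons (1%R, 0%R) *m O = nu ->
  Gamma t = flat_crack_bonds Omega eps p nu S ->
  failure_energy Omega J Cp eps Gamma t =
  (critical_energy_release_rate n.+1 J Cp)%:E * lebesgue_rV n (plane_chart O p @^-1` S).
Proof.
move=> OO Onu GammaE; rewrite failure_energy_density//.
have mtJ d (T : measurableType d) (f : T -> 'rV[R]_n.+1) : measurable_fun setT f ->
    measurable_fun setT (fun z => truncJ J (enorm (f z) / eps)).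
  move=> mf; apply: (measurableT_comp (measurable_truncJ hJ)).
  by apply: measurable_funM => //; exact: measurable_enorm.
have mdens d (T : measurableType d) (f g : T -> 'rV[R]_n.+1) :
    measurable_fun setT f -> measurable_fun setT g ->
    measurable_fun setT (fun z => (density (f z) (g z))%:E).
  move=> mf mg; apply/measurable_EFinP; apply: measurable_funM.
    by apply: measurable_funM => //; apply: mtJ; exact: measurable_rVB.
  rewrite (_ : (fun _ => _) = \1_([set z | crosses p nu S (f z) (g z)])); last by [].
  by apply: measurable_indic; exact: measurable_crosses.
have dens0 x y : 0 <= (density x y)%:E.
  by rewrite lee_fin; apply: (mulr_ge0 (KJ_ge0 _)); rewrite indicE ler0n.
transitivity (\int[lebesgue_rV n.+1]_x \int[lebesgue_rV n.+1]_xi (density x (xi + x))%:E).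
  apply: eq_integral => x _.
  by rewrite (@ge0_integral_shift R n.+1 x (fun y => (density x y)%:E))//; exact: mdens.
rewrite (@fubini_tonelli _ _ _ _ R (lebesgue_rV n.+1) (lebesgue_rV n.+1)
  (fun z => (density z.1 (z.2 + z.1))%:E))//; last first.
  by apply: mdens => //; exact: measurable_rVD.
have mS' : measurable (plane_chart O p @^-1` S).
  by apply: measurable_preimage => //; exact: measurable_plane_chart.
pose L := lebesgue_rV n (plane_chart O p @^-1` S).
pose f xi : \bar R := (K * truncJ J (enorm xi / eps) * `|dotp nu xi|)%:E.
have mf : measurable_fun setT f.
  apply/measurable_EFinP; apply: measurable_funM.
    by apply: measurable_funM => //; exact: mtJ.
  by apply: measurableT_comp => //; exact: measurable_dotp.
have f0 xi : 0 <= f xi by rewrite lee_fin; exact: (mulr_ge0 (KJ_ge0 _) (normr_ge0 _)).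
transitivity (\int[lebesgue_rV n.+1]_xi (L * f xi)).
  apply: eq_integral => xi _ /=.
  transitivity (\int[lebesgue_rV n.+1]_x ((K * truncJ J (enorm xi / eps))%:E *
      (\1_[set x | crosses p nu S x (x + xi)] x)%:E)).
    apply: eq_integral => x _; rewrite -EFinM /density addrK; congr (_ * _)%:E.
    rewrite !indicE; congr (nat_of_bool _)%:R%R.
    by apply/idP/idP; rewrite !inE/= addrC.
  have mcr : measurable [set x | crosses p nu S x (x + xi)].
    by apply: measurable_crosses => //; exact: measurable_rVD.
  rewrite ge0_integralZl//; last 2 first.
  - exact: measurable_indicE.
  - by rewrite lee_fin; exact: KJ_ge0.
  rewrite [X in _ * X = _](_ : _ = L * `|dotp nu xi|%:E); last first.
    by rewrite -(lebesgue_crosses OO Onu _ Sp mS) [RHS]measure_integral_indic.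
  by rewrite muleCA -EFinM.
rewrite ge0_integralZl//; last exact: measure_ge0.
rewrite muleC; congr (_ * _).
(* The rotation makes [nu . xi] the first coordinate. Dilation by [eps] then gives [eps^(n+1)] from
   the volume and one more [eps] from that coordinate, which cancel the powers of [eps] in [K]: the
   release rate does not depend on [eps]. *)
rewrite -(ge0_integral_orthogonal OO)//.
rewrite -(@ge0_integral_affine R n.+1 eps 0)//; last 2 first.
- by rewrite gt_eqF.
- by apply: measurableT_comp => //; exact: measurable_rV_mulmx.
transitivity ((`|eps| ^+ n.+1)%:E * \int[lebesgue_rV n.+1]_z
    ((K * eps)%:E * (`|z ord0 ord0| * truncJ J (enorm z))%:E)).
  congr (_ * _); apply: eq_integral => z _; rewrite /f -EFinM; congr EFin.
  rewrite addr0 enorm_orthogonal// (dotp_normal OO Onu) enormZ mxE normrM (gtr0_norm eps0).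
  by rewrite [(eps * enorm z)%R]mulrC mulfK ?gt_eqF//; ring.
have mz : measurable_fun setT
    (fun z : 'rV[R]_n.+1 => (`|z ord0 ord0| * truncJ J (enorm z))%:E).
  apply/measurable_EFinP; apply: measurable_funM.
    by apply: measurableT_comp => //; exact: (measurable_rV_coord (ord0 : 'I_n.+1)).
  by apply: (measurableT_comp (measurable_truncJ hJ)); exact: measurable_enorm.
rewrite ge0_integralZl//; last 2 first.
- by move=> z _; rewrite lee_fin mulr_ge0//; exact: (truncJ_ge0 hJ).
- by rewrite lee_fin; exact: (mulr_ge0 K_ge0 (ltW eps0)).
rewrite (integral_norm_coord (truncJ_ge0 hJ) (truncJ_noninc hJ) (truncJ_eq0 hJ)).
rewrite (integral_truncJ hJ) -!EFinM; congr EFin.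
rewrite /critical_energy_release_rate/= /K (gtr0_norm eps0).
by field; rewrite expf_neq0 !gt_eqF ?unit_ball_volume_gt0.
Qed.

End flat_crack.
End energy.

Theorem mainTheorem7 (R : realType) (d : nat) (hd : d = 2%N \/ d = 3%N)
    (Omega : set 'rV[R]_d) (hOmega : domain Omega)
    (hOmega_bounded : bounded_set Omega)
    (Cp : R) (hCp : 0 < Cp)
    (J : R -> R) (M : R) (hJ : influence_function J M)
    (eps : R) (heps : 0 < eps)
    (Gamma : R -> set ('rV[R]_d * 'rV[R]_d)) (t : R)
    (p nu : 'rV[R]_d) (Rt : set 'rV[R]_d) (hRt : flat_piece p nu Rt)
    (hRtOmega : Rt `<=` Omega)
    (hRt_interior : forall x, Rt x -> horizon eps x `<=` Omega)
    (hGamma : Gamma t = flat_crack_bonds Omega eps p nu Rt) :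
  (failure_energy Omega J Cp eps Gamma t =
   (critical_energy_release_rate d J Cp)%:E * hausdorff_measure d.-1 Rt)%E.
Proof.
(* The crack has dimension [d - 1 = n + 1 > 0], as the comparison of Hausdorff and Lebesgue measure
   requires. *)
have [n dE] : exists n, d = n.+2 by case: hd => ->; [exists 0%N|exists 1%N].
subst d.
have [nu1 Rtp mRt] := hRt.
have e_nu : enorm (rV_cons (1, 0) : 'rV[R]_n.+2) = enorm nu.
  by rewrite nu1 enorm_cons enorm0 expr1n expr0n addr0 sqrtr1.
have [P PP Pnu] := exists_orthogonal e_nu.
rewrite (failure_energy_flat hCp hJ heps hRt hRt_interior PP Pnu hGamma).
(* The energy involves the Lebesgue measure of the chart preimage of [Rt]; [Rt] is the isometric
   image of that preimage, so its Hausdorff measure is the same number. *)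
congr (_ * _)%E; rewrite [in RHS](hyperplane_chart PP Pnu Rtp)/=.
rewrite hausdorff_measure_isometry; last exact: plane_chart_isometry.
rewrite hausdorff_measure_lebesgue//.
by apply: measurable_preimage => //; exact: measurable_plane_chart.
Qed.
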